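(* Let $N\ge K\ge1$, $\mathbf{H}\in\mathbb{R}^{N\times K}$ full column rank, with orthonormal eigenvectors $\mathbf{u}_1,\ldots,\mathbf{u}_N$ of $\mathbf{H}\mathbf{H}^T$, $\mathbf{H}\mathbf{H}^T\mathbf{u}_i=\rho_i^2\mathbf{u}_i$, $\rho_1^2\ge\cdots\ge\rho_N^2\ge0$, $\rho_1^2>\rho_N^2$. Let $M_1,M_2$ be positive integers, $M=M_1+M_2$, and use the measurement matrix $\boldsymbol{\Phi}=[\boldsymbol{\Phi}_s^T,\boldsymbol{\Phi}_o^T]^T$ with $\boldsymbol{\Phi}_s=\frac{1}{\sqrt M}\mathbf{1}_{M_1,1}\otimes\mathbf{u}_1^T$ and $\boldsymbol{\Phi}_o=\frac{1}{\sqrt M}\mathbf{1}_{M_2,1}\otimes\mathbf{u}_N^T$. Define $\bar z_s[n]=\frac{1}{M_1}\mathbf{1}_{1,M_1}\mathbf{z}_s[n]$ and $\bar z_o[n]=\frac{1}{M_2}\mathbf{1}_{1,M_2}\mathbf{z}_o[n]$, and for $\gamma>0$ consider the test deciding $\mathcal{H}_1$ when $$\mathcal{T}=\frac{M_1\sum_{n=1}^{N_b}|\bar z_s[n]|^2}{M_2\sum_{n=1}^{N_b}|\bar z_o[n]|^2}>\gamma.$$ Then $P_{FA}=\mathbb{Q}_{F(N_b,N_b)}(\gamma)$ and $$P_D=\mathbb{Q}_{F(N_b,N_b)}\Big(\frac{\sigma_0^2+M_2\sigma_x^2\rho_N^2}{\sigma_0^2+M_1\sigma_x^2\rho_1^2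}\gamma\Big).$$
   Context: Observations over $n=1,\ldots,N_b$: rows $\boldsymbol{\phi}_m^T$ of $\boldsymbol{\Phi}$ represent $M$ devices; under $\mathcal{H}_0$ device $m$ outputs $z_m[n]=\boldsymbol{\phi}_m^T\mathbf{w}_m[n]$, and under $\mathcal{H}_1$ it outputs $z_m[n]=\boldsymbol{\phi}_m^T(\mathbf{H}\mathbf{x}[n]+\mathbf{w}_m[n])$, where $\mathbf{x}[n]\sim\mathcal{N}(\mathbf{0}_{K,1},\sigma_x^2\mathbf{I}_K)$ and $\mathbf{w}_m[n]\sim\mathcal{N}(\mathbf{0}_{N,1},\sigma_0^2\mathbf{I}_N)$, $\sigma_0^2>0$, all mutually independent across $m$ and $n$. $\mathbf{z}_s[n]$ collects the outputs of the first $M_1$ devices (rows of $\boldsymbol{\Phi}_s$), $\mathbf{z}_o[n]$ those of the last $M_2$. $\mathbf{1}_{P,Q}$ is the $P\times Q$ all-ones matrix; $\otimes$ the Kronecker product. $P_{FA}=\Pr(\mathcal{T}>\gamma\mid\mathcal{H}_0)$, $P_D=\Pr(\mathcal{T}>\gamma\mid\mathcal{H}_1)$; $\mathbb{Q}_{F(d_1,d_2)}(x)=\Pr(X>x)$ for $X$ $F$-distributed with $(d_1,d_2)$ degrees of freedom. *)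

(* Defs.v *)
From HB Require Import structures.
From mathcomp Require Import all_boot all_order all_algebra.
From mathcomp Require Import all_classical all_reals all_analysis.
Set Implicit Arguments. Unset Strict Implicit. Unset Printing Implicit Defensive.
Import Order.TTheory GRing.Theory Num.Theory.
Import numFieldNormedType.Exports.
Local Open Scope classical_set_scope.
Local Open Scope ring_scope.

Section defs.
Context {R : realType}.

(** Real random variable [X] has law N(0, s^2) (s = standard deviation > 0). *)
Definition has_normal_law d (T : measurableType d) (P : probability T R)
    (s : R) (X : T -> R) : Prop :=
  measurable_fun setT X /\
  forall A : set R, measurable A -> P (X @^-1` A) = normal_prob 0 s A.

(** Mutual independence of a finite family of real random variables
    (product rule for every choice of Borel sets; taking [B i = setT]
    recovers every subfamily). *)
Definition mutually_independent d (T : measurableType d) (P : probability T R)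
    (I : finType) (X : I -> T -> R) : Prop :=
  forall B : I -> set R, (forall i, measurable (B i)) ->
    P (\bigcap_(i in [set: I]) (X i @^-1` B i)) =
    (\prod_(i : I) P (X i @^-1` B i))%E.

(** Measurement matrix Phi = [Phi_s ; Phi_o],
    Phi_s = 1/sqrt M * (1_{M1,1} (x) u1^T),  Phi_o = 1/sqrt M * (1_{M2,1} (x) uN^T);
    the Kronecker product of a column 1_{P,1} with a row v^T is the outer
    product 1_{P,1} *m v^T. *)
Definition Phi (N M1 M2 : nat) (u1 uN : 'cV[R]_N) : 'M[R]_(M1 + M2, N) :=
  (Num.sqrt (M1 + M2)%:R)^-1 *:
    col_mx (@const_mx R M1 1 1 *m u1^T) (@const_mx R M2 1 1 *m uN^T).

Definition vec_of (N : nat) (T : Type) (f : 'I_N -> T -> R) (t : T) : 'cV[R]_N :=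
  \col_j f j t.

Definition z_H0 (N M Nb : nat) (T : Type) (Ph : 'M[R]_(M, N))
    (w : 'I_M -> 'I_Nb -> 'I_N -> T -> R) (m : 'I_M) (n : 'I_Nb) (t : T) : R :=
  (row m Ph *m vec_of (w m n) t) 0 0.

Definition z_H1 (N K M Nb : nat) (T : Type) (Ph : 'M[R]_(M, N)) (H : 'M[R]_(N, K))
    (w : 'I_M -> 'I_Nb -> 'I_N -> T -> R) (x : 'I_Nb -> 'I_K -> T -> R)
    (m : 'I_M) (n : 'I_Nb) (t : T) : R :=
  (row m Ph *m (H *m vec_of (x n) t + vec_of (w m n) t)) 0 0.

Definition zbar_s (M1 M2 Nb : nat) (T : Type)
    (z : 'I_(M1 + M2) -> 'I_Nb -> T -> R) (n : 'I_Nb) (t : T) : R :=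
  (M1%:R)^-1 * \sum_(m < M1) z (lshift M2 m) n t.

Definition zbar_o (M1 M2 Nb : nat) (T : Type)
    (z : 'I_(M1 + M2) -> 'I_Nb -> T -> R) (n : 'I_Nb) (t : T) : R :=
  (M2%:R)^-1 * \sum_(m < M2) z (rshift M1 m) n t.

Definition Tstat (M1 M2 Nb : nat) (T : Type)
    (z : 'I_(M1 + M2) -> 'I_Nb -> T -> R) (t : T) : R :=
  (M1%:R * \sum_(n < Nb) (zbar_s z n t) ^+ 2) /
  (M2%:R * \sum_(n < Nb) (zbar_o z n t) ^+ 2).

(** Unnormalised density of the F(d1,d2) distribution on (0, +oo). *)
Definition F_kernel (d1 d2 : nat) (t : R) : R :=
  powR t (d1%:R / 2 - 1) * powR (1 + d1%:R * t / d2%:R) (- ((d1 + d2)%:R / 2)).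

(** Q_{F(d1,d2)}(x) = Pr(X > x) for X ~ F(d1,d2): the density is the kernel
    normalised by its total integral over (0,+oo). *)
Definition QF (d1 d2 : nat) (x : R) : R :=
  Rintegral lebesgue_measure (`]x, +oo[ `&` `]0, +oo[) (F_kernel d1 d2) /
  Rintegral lebesgue_measure `]0, +oo[ (F_kernel d1 d2).

End defs.

(* Main.v *)
Require Import Defs.
From HB Require Import structures.
From mathcomp Require Import all_boot all_order all_algebra.
From mathcomp Require Import all_classical all_reals all_analysis.
From mathcomp Require Import measurable_realfun ring.
Set Implicit Arguments. Unset Strict Implicit. Unset Printing Implicit Defensive.
Import Order.TTheory GRing.Theory Num.Theory.
Local Open Scope classical_set_scope.
Local Open Scope ring_scope.

(** Under either hypothesis the 2 Nb averages zbar_s[n], zbar_o[n] are linear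
    combinations of the independent centred Gaussians w and x whose coefficient
    vectors are pairwise orthogonal: different devices feed the two averages,
    and H^T u_1 is orthogonal to H^T u_N since u_1, u_N are orthogonal
    eigenvectors of H H^T. Rotating two coordinates at a time, which preserves
    a standard Gaussian family, turns the normalised averages into coordinates,
    so they are i.i.d. N(0,1). Hence the statistic is va U / (vb V) with U, V
    independent chi-square variables with Nb degrees of freedom. The density of
    U is obtained by convolution, and that of U / V by one more substitution;
    no normalising constant is ever computed, total mass 1 determines it. The
    hypothesis H_0 is the case H = 0. *)

(** * Affine substitutions and plane rotations for Lebesgue integrals *)

Section lebesgue_substitution.
Context {R : realType}.
Local Notation mu := (@lebesgue_measure R).
Local Open Scope ereal_scope.

(** Every change of variables is reduced, by Tonelli, to the affine one on the line: a rotation is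
    two successive one-variable substitutions, the quotient is a rescaling of the inner variable,
    and squaring is treated by homogeneity under rescaling. All these identities hold for
    nonnegative extended-valued integrands, so a constant may be infinite until a total mass of 1
    shows that it is finite. The recurring obstacle is that a coordinate must be treated as
    independent of a function of the other ones. This is done with events: a family is called
    standard Gaussian relative to an event [E], in product form, and a constraint on some
    coordinates is moved into [E]. Rotations, the removal of coordinates and orthonormal
    recombination all respect this notion, so a joint law has to be checked on rectangles only. A
    vanishing denominator costs nothing: the quotient is then 0 by convention, hence below the
    positive threshold, and the event where the statistic exceeds it lies inside the event where the
    denominator is positive. *)

Lemma measurable_affine (a b : R) :
  measurable_fun setT (fun x : R => a * x + b)%R.
Proof. by apply: measurable_funD => //; exact: measurable_funM. Qed.

(** Uniqueness of Lebesgue measure: the pushforward along the affine map, scaled by [|a|], gives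
    half-open intervals their length. For [a < 0] the preimage of []x, y]] is closed at the other
    end, with the same length. *)
Lemma lebesgue_measure_affine (a b : R) (A : set R) : a != 0%R -> measurable A ->
  mu A = `|a|%:E * mu ((fun x => a * x + b)%R @^-1` A).
Proof.
move=> a0 mA.
pose phi : measurableTypeR R -> measurableTypeR R := fun x => (a * x + b)%R.
have mphi : measurable_fun setT phi by exact: measurable_affine.
pose mphi_mixin := isMeasurableFun.Build _ _ _ _ _ mphi.
pose mphi_pack : {mfun _ >-> _} := HB.pack phi mphi_mixin.
have an0 : (0 <= `|a|)%R by [].
rewrite (@lebesgue_measure_unique R (mscale (NngNum an0) (pushforward mu mphi_pack)))//.
move=> _ [[x y]] _ <- /=; rewrite /mscale/= /pushforward/=.
rewrite lebesgue_measure_itv/=.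
have [ap|an|/eqP] := ltgtP 0%R a; last by rewrite eq_sym (negbTE a0).
- have -> : phi @^-1` `]x, y] = `]((x - b) / a)%R, ((y - b) / a)%R]%classic.
    apply/seteqP; split => t /=; rewrite /phi !in_itv/= ltr_pdivrMr// ler_pdivlMr//;
    by rewrite ltrBlDr lerBrDr mulrC.
  rewrite lebesgue_measure_itv/= !lte_fin ltr_pM2r ?invr_gt0// ltrD2r.
  case: ifPn => _; last by rewrite mule0.
  by rewrite gtr0_norm// -EFinD -!EFinM; congr _%:E; field.
- have -> : phi @^-1` `]x, y] = `[((y - b) / a)%R, ((x - b) / a)%R[%classic.
    apply/seteqP; split => t /=; rewrite /phi !in_itv/= ltr_ndivlMr// ler_ndivrMr//;
    by rewrite ltrBlDr lerBrDr mulrC andbC.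
  rewrite lebesgue_measure_itv/= !lte_fin ltr_nM2r ?invr_lt0// ltrD2r.
  case: ifPn => _; last by rewrite mule0.
  by rewrite ltr0_norm// -EFinD -!EFinM; congr _%:E; field.
Qed.

Lemma ge0_integral_affine (f : R -> \bar R) (a b : R) : a != 0%R ->
  measurable_fun setT f -> (forall x, 0 <= f x) ->
  \int[mu]_x f x = `|a|%:E * \int[mu]_x f (a * x + b)%R.
Proof.
move=> a0 mf f0.
pose phi : measurableTypeR R -> measurableTypeR R := fun x => (a * x + b)%R.
have mphi : measurable_fun setT phi by exact: measurable_affine.
pose mphi_mixin := isMeasurableFun.Build _ _ _ _ _ mphi.
pose mphi_pack : {mfun _ >-> _} := HB.pack phi mphi_mixin.
have an0 : (0 <= `|a|)%R by [].
rewrite (@eq_measure_integral _ _ _ _ (mscale (NngNum an0) (pushforward mu mphi_pack))).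
  rewrite ge0_integral_mscale//; congr (_ * _).
  by rewrite (@ge0_integral_pushforward _ _ _ _ R phi)//.
by move=> A mA _; exact: lebesgue_measure_affine.
Qed.

Lemma ge0_integral_affineZ (f : R -> \bar R) (a b : R) : a != 0%R ->
  measurable_fun setT f -> (forall x, 0 <= f x) ->
  \int[mu]_x f x = \int[mu]_x (`|a|%:E * f (a * x + b)%R).
Proof.
move=> a0 mf f0; rewrite (ge0_integral_affine b a0 mf f0) ge0_integralZl//.
exact: (measurableT_comp mf (measurable_affine a b)).
Qed.

Lemma tonelli2 (f : R -> R -> \bar R) :
  measurable_fun setT (fun z : R * R => f z.1 z.2) -> (forall x y, 0 <= f x y) ->
  \int[mu]_x \int[mu]_y f x y = \int[mu]_y \int[mu]_x f x y.
Proof.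
by move=> mf f0; apply: (@fubini_tonelli _ _ _ _ _ mu mu (fun z => f z.1 z.2)) => //.
Qed.

Lemma measurable_integral2r (f : R -> R -> \bar R) :
  measurable_fun setT (fun z : R * R => f z.1 z.2) -> (forall x y, 0 <= f x y) ->
  measurable_fun setT (fun x => \int[mu]_y f x y).
Proof.
move=> mf f0.
by have := @measurable_fun_fubini_tonelli_F _ _ _ _ R mu _ mf (fun z => f0 z.1 z.2).
Qed.

Lemma measurable_integral2l (f : R -> R -> \bar R) :
  measurable_fun setT (fun z : R * R => f z.1 z.2) -> (forall x y, 0 <= f x y) ->
  measurable_fun setT (fun y => \int[mu]_x f x y).
Proof.
move=> mf f0.
by have := @measurable_fun_fubini_tonelli_G _ _ _ _ R mu _ mf (fun z => f0 z.1 z.2).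
Qed.

(** For [c != 0], substituting [x = (u - s y) / c] at fixed [y] turns the second argument into
    [(y - s u) / c], because [c^2 + s^2 = 1]; the substitution in [y] at fixed [u] then brings the
    same factor [|1/c|] on the other side. For [c = 0] the rotation exchanges the coordinates up to
    sign. *)
Lemma ge0_integral_rotation (f : R -> R -> \bar R) (c s : R) :
  (c ^+ 2 + s ^+ 2 = 1)%R ->
  measurable_fun setT (fun z : R * R => f z.1 z.2) -> (forall x y, 0 <= f x y) ->
  \int[mu]_x \int[mu]_y f (c * x + s * y)%R (c * y - s * x)%R =
  \int[mu]_x \int[mu]_y f x y.
Proof.
move=> cs mf f0.
have mcomp d (T : measurableType d) (g h : T -> R) : measurable_fun setT g ->
    measurable_fun setT h -> measurable_fun setT (fun z => f (g z) (h z)).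
  by move=> mg mh; apply: (measurableT_comp mf (measurable_fun_pair mg mh)).
have m1 : measurable_fun setT (fst : R * R -> R) by exact: measurable_fst.
have m2 : measurable_fun setT (snd : R * R -> R) by exact: measurable_snd.
have mxy x : measurable_fun setT (f x).
  exact: mcomp.
have myx y : measurable_fun setT (f^~ y).
  exact: mcomp.
have mM (k : R) (g : R * R -> R) : measurable_fun setT g ->
    measurable_fun setT (fun z => k * g z)%R.
  by move=> mg; exact: measurable_funM.
have [c0|c0] := eqVneq c 0%R.
  have s0 : s != 0%R.
    apply/eqP => s0; move: cs; rewrite c0 s0 !expr0n/= addr0 => /eqP.
    by rewrite eq_sym oner_eq0.
  have s1 : (`|s| = 1)%R.
    by apply/eqP; rewrite -sqrp_eq1// real_normK ?num_real// -cs c0; apply/eqP; ring.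
  transitivity (\int[mu]_x \int[mu]_y f y (- (s * x))%R).
    apply: eq_integral => x _.
    rewrite [RHS](@ge0_integral_affine (f^~ _) s 0%R)// s1 mul1e.
    by apply: eq_integral => y _; congr (f _ _); rewrite c0; ring.
  rewrite (@tonelli2 (fun x y => f y (- (s * x))%R))//=; last first.
    by apply: mcomp => //; apply: measurable_funN; exact: mM.
  apply: eq_integral => y _.
  have sN0 : (- s != 0)%R by rewrite oppr_eq0.
  have := @ge0_integral_affine (f y) (- s) 0 sN0 (mxy _) (fun _ => f0 _ _).
  rewrite normrN s1 mul1e => ->.
  by apply: eq_integral => x _; rewrite addr0 mulNr.
rewrite (@tonelli2 (fun x y => f (c * x + s * y) (c * y - s * x))%R)//; last first.
  by apply: mcomp; [apply: measurable_funD|apply: measurable_funB]; exact: mM.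
have ci0 : (c^-1 != 0)%R by rewrite invr_eq0.
pose g (u y : R) := f u (c^-1 * y + - (s * u / c))%R.
have mg : measurable_fun setT (fun z : R * R => g z.1 z.2).
  apply: mcomp => //; apply: measurable_funD; first exact: mM.
  by apply: measurable_funN; apply: measurable_funM => //; exact: mM.
have g0 u y : 0 <= g u y by exact: f0.
transitivity (\int[mu]_y (`|c^-1|%:E * \int[mu]_u g u y)).
  apply: eq_integral => y _.
  rewrite (@ge0_integral_affine _ c^-1 (- (s * y / c))%R)//; last first.
    by apply: mcomp; [apply: measurable_funD|apply: measurable_funB] => //;
      exact: measurable_funM.
  congr (_ * _); apply: eq_integral => u _; congr (f _ _); first by field.
  apply: (mulfI c0); rewrite mulrBr.
  by transitivity ((c ^+ 2 + s ^+ 2) * y - s * u)%R; [field|rewrite cs; field].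
rewrite ge0_integralZl//; first last.
- by move=> y _; apply: integral_ge0.
- exact: measurable_integral2l.
rewrite -(tonelli2 mg)// -ge0_integralZl//; first last.
- by move=> y _; apply: integral_ge0.
- exact: measurable_integral2r.
apply: eq_integral => u _.
by rewrite [RHS](@ge0_integral_affine _ c^-1 (- (s * u / c))%R).
Qed.

End lebesgue_substitution.

(** * Measures with a density and joint laws of pairs *)

Section density_measure.
Context d (T : measurableType d) (R : realType).
Variables (m : {measure set T -> \bar R}) (k : T -> \bar R).
Hypotheses (mk : measurable_fun setT k) (k0 : forall x, (0 <= k x)%E).
Local Open Scope ereal_scope.

(** The two proofs are arguments so that the measure structure can be attached to the term
    itself. *)
Definition density_measure of measurable_fun setT k & (forall x, 0 <= k x) :=
  fun A : set T => \int[m]_(x in A) k x.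

Local Notation dm := (density_measure mk k0).

Let dm0 : dm set0 = 0. Proof. exact: integral_set0. Qed.

Let dm_ge0 A : 0 <= dm A. Proof. by apply: integral_ge0 => x _; exact: k0. Qed.

Let dm_sigma_additive : semi_sigma_additive dm.
Proof.
move=> F mF tF mUF; rewrite /density_measure ge0_integral_bigcup//; last first.
  exact: measurable_funTS.
by apply: is_cvg_ereal_nneg_natsum_cond => n _ _; exact: dm_ge0.
Qed.

HB.instance Definition _ := isMeasure.Build _ _ _ dm dm0 dm_ge0 dm_sigma_additive.

End density_measure.

Section joint_density.
Context {R : realType}.
Local Notation mu := (@lebesgue_measure R).
Local Open Scope ereal_scope.

Variables (k1 k2 : R -> R).
Hypotheses (mk1 : measurable_fun setT k1) (mk2 : measurable_fun setT k2).
Hypotheses (k10 : forall x, (0 <= k1 x)%R) (k20 : forall x, (0 <= k2 x)%R).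

Lemma measurable_indic_density (C : set (R * R)) : measurable C ->
  measurable_fun setT (fun z : R * R => (\1_C z * (k1 z.1 * k2 z.2))%:E).
Proof.
move=> mC; apply/measurable_EFinP; apply: measurable_funM; first exact: measurable_indic.
by apply: measurable_funM; apply: measurableT_comp.
Qed.

Lemma integral2_rectangle (A B : set R) : measurable A -> measurable B ->
  \int[mu]_x \int[mu]_y (\1_(A `*` B) (x, y) * (k1 x * k2 y))%:E =
  \int[mu]_(x in A) (k1 x)%:E * \int[mu]_(y in B) (k2 y)%:E.
Proof.
move=> mA mB.
have mk2e : measurable_fun setT (fun y => (k2 y)%:E) by exact/measurable_EFinP.
have mk1e : measurable_fun setT (fun y => (k1 y)%:E) by exact/measurable_EFinP.
rewrite -ge0_integralZr//; last 3 first.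
- exact: measurable_funTS.
- by move=> x _; rewrite lee_fin.
- by apply: integral_ge0 => x _; rewrite lee_fin.
rewrite [RHS]integral_mkcond; apply: eq_integral => x _.
rewrite patchE; case: ifPn => xA.
  rewrite -ge0_integralZl//; last 3 first.
  - exact: measurable_funTS.
  - by move=> y _; rewrite lee_fin.
  - by rewrite lee_fin.
  rewrite [RHS]integral_mkcond; apply: eq_integral => y _.
  rewrite patchE indicE in_setX/= xA/=; case: ifPn => _; first by rewrite mul1r EFinM.
  by rewrite mul0r.
by rewrite integral0_eq// => y _; rewrite indicE in_setX/= (negbTE xA)/= mul0r.
Qed.

(** Both sides are finite measures in [C] that agree on rectangles, a generating family closed under
    intersection. The event [E] enters through the factor [P E] and not through a conditional
    probability, so [P E = 0] is harmless. *)
Lemma joint_density d (T : measurableType d) (P : probability T R) (E : set T)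
    (X Y : T -> R) (C : set (R * R)) :
  measurable E -> measurable_fun setT X -> measurable_fun setT Y ->
  (forall A B, measurable A -> measurable B ->
    P [set t | [/\ E t, A (X t) & B (Y t)]] =
    P E * (\int[mu]_(x in A) (k1 x)%:E * \int[mu]_(y in B) (k2 y)%:E)) ->
  measurable C ->
  P [set t | E t /\ C (X t, Y t)] =
  P E * \int[mu]_x \int[mu]_y (\1_C (x, y) * (k1 x * k2 y))%:E.
Proof.
move=> mE mX mY PXY mC.
pose XY t := (X t, Y t).
have mXY : measurable_fun setT XY by exact: measurable_fun_pair.
pose k (z : R * R) := (k1 z.1 * k2 z.2)%:E.
have mk : measurable_fun setT k.
  by apply/measurable_EFinP; apply: measurable_funM; apply: measurableT_comp.
have k0 z : 0 <= k z by rewrite lee_fin mulr_ge0.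
have PE0 : (0 <= fine (P E))%R by rewrite fine_ge0.
(* [R] and [measurableTypeR R] have the same measurable sets but different
   displays, hence the casts. *)
have [m1 m1E] :
    exists m : {measure set (measurableTypeR R * measurableTypeR R) -> \bar R},
    forall D, m D = P (XY @^-1` D `&` E).
  pose XY' : T -> measurableTypeR R * measurableTypeR R := XY.
  have mXY' : measurable_fun setT XY' by exact: mXY.
  by unshelve eexists (pushforward (mrestr P mE) XY').
have [m2 m2E] :
    exists m : {measure set (measurableTypeR R * measurableTypeR R) -> \bar R},
    forall D, m D = P E * density_measure (mu \x mu)%E mk k0 D.
  exists (mscale (NngNum PE0) (density_measure (mu \x mu)%E mk k0)) => D.
  have PEE : (fine (P E))%:E = P E by rewrite fineK// fin_num_measure.
  by rewrite -[in RHS]PEE.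
have kE D : measurable D -> density_measure (mu \x mu)%E mk k0 D =
    \int[mu]_x \int[mu]_y (\1_D (x, y) * (k1 x * k2 y))%:E.
  move=> mD; rewrite /density_measure integral_mkcond.
  have mkD : measurable_fun setT (k \_ D).
    by apply/(measurable_restrictT k) => //; exact: measurable_funTS.
  have kD0 z : 0 <= (k \_ D) z by rewrite patchE; case: ifPn.
  rewrite (@fubini_tonelli1 _ _ _ _ R mu mu (k \_ D) mkD kD0).
  apply: eq_integral => x _; apply: eq_integral => y _.
  rewrite patchE indicE; case: ifPn => _; first by rewrite mul1r.
  by rewrite mul0r.
have -> : [set t | E t /\ C (X t, Y t)] = XY @^-1` C `&` E.
  by apply/seteqP; split => t /= [].
rewrite -kE// -m1E -m2E.
pose G : set (set (measurableTypeR R * measurableTypeR R)) :=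
  [set D | exists A, measurable A /\ exists B, measurable B /\ D = A `*` B].
apply: (measure_unique G (fun=> setT)) => //.
- rewrite measurable_prod_measurableType //; congr (<<s _ >>).
  rewrite predeqE; split => [[A mA [B mB <-]]|[A [mA [B [mB ->]]]]].
    by exists A; split => //; exists B.
  by exists A => //; exists B.
- move=> /= _ _ [X1 [mX1 [X2 [mX2 ->]]]] [Y1 [mY1 [Y2 [mY2 ->]]]].
  rewrite -setXI; exists (X1 `&` Y1); split; first exact: measurableI.
  by exists (X2 `&` Y2); split => //; exact: measurableI.
- by move=> _; exists setT; split => //; exists setT; split => //; rewrite setXTT.
- by rewrite bigcup_const.
- move=> D [A [mA [B [mB ->]]]]; rewrite m1E m2E kE; last exact: measurableX.
  rewrite integral2_rectangle// -PXY//; congr (P _).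
  by apply/seteqP; split => t /=; [move=> [[]]|move=> []].
- move=> _; rewrite m1E preimage_setT setTI.
  by rewrite ltey_eq fin_num_measure.
Qed.

End joint_density.

Section rotation_invariant_density.
Context {R : realType}.
Local Notation mu := (@lebesgue_measure R).
Local Open Scope ereal_scope.

(** As the product density is unchanged by the rotation, the integrand is that of the straight
    rectangle composed with the rotation. *)
Lemma integral2_rotated_rectangle (k : R -> R) (c s : R) (A B : set R) :
  measurable_fun setT k -> (forall x, (0 <= k x)%R) -> (c ^+ 2 + s ^+ 2 = 1)%R ->
  (forall x y, k (c * x + s * y) * k (c * y - s * x) = k x * k y)%R ->
  measurable A -> measurable B ->
  \int[mu]_x \int[mu]_y (\1_[set z | A (c * z.1 + s * z.2)%R /\
    B (c * z.2 - s * z.1)%R] (x, y) * (k x * k y))%:E =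
  \int[mu]_(x in A) (k x)%:E * \int[mu]_(y in B) (k y)%:E.
Proof.
move=> mk k0 cs krot mA mB.
rewrite -(integral2_rectangle mk mk k0 k0 mA mB).
pose f (x y : R) := (\1_(A `*` B) (x, y) * (k x * k y))%:E.
have mf : measurable_fun setT (fun z : R * R => f z.1 z.2).
  have := measurable_indic_density mk mk (measurableX mA mB).
  by apply: eq_measurable_fun => -[x y] _.
have f0 x y : 0 <= f x y by rewrite lee_fin !mulr_ge0.
rewrite -[RHS](ge0_integral_rotation cs mf f0).
apply: eq_integral => x _; apply: eq_integral => y _; rewrite /f krot.
congr (_ * _)%:E; rewrite !indicE; congr (_%:R); congr nat_of_bool.
Qed.

End rotation_invariant_density.

(** * Standard Gaussian families relative to an event *)

Section gaussian_family.
Context {R : realType} d (T : measurableType d) (P : probability T R).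
Local Notation mu := (@lebesgue_measure R).
Local Notation N01 := (@normal_prob R 0 1).
Local Notation phi := (@normal_pdf R 0 1).

(** For [E = setT] these are i.i.d. N(0,1) variables; in general, the same under the conditional law
    given [E], written without division. The event stores the constraints on coordinates already set
    aside. *)
Definition iid_normal (E : set T) n (X : 'I_n -> T -> R) :=
  (forall i, measurable_fun setT (X i)) /\
  forall B : 'I_n -> set R, (forall i, measurable (B i)) ->
    P [set t | E t /\ forall i, B i (X i t)] = (P E * \prod_(i < n) N01 (B i))%E.

(** A Givens rotation in the plane of the coordinates [i] and [j]. *)
Definition pair_rotation (c s : R) n (i j : 'I_n) (v : 'I_n -> R) (k : 'I_n) : R :=
  if k == i then c * v i + s * v j
  else if k == j then c * v j - s * v i else v k.

Lemma normal_pdf01E x : phi x = normal_peak 1 * expR (- x ^+ 2 / 2).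
Proof.
by rewrite normal_pdfE ?oner_eq0// /normal_fun subr0 expr1n mulr2n.
Qed.

Lemma normal_pdf_rotation (c s x y : R) : c ^+ 2 + s ^+ 2 = 1 ->
  phi (c * x + s * y) * phi (c * y - s * x) = phi x * phi y.
Proof.
move=> cs; rewrite !normal_pdf01E mulrACA -expRD [RHS]mulrACA -expRD.
congr (_ * expR _).
transitivity (- (c ^+ 2 + s ^+ 2) * (x ^+ 2 + y ^+ 2) / 2); first by field.
by rewrite cs; field.
Qed.

(** The constraints on all coordinates other than [i] and [j] are absorbed into the event [E'].
    Relative to it, the pair has the density [phi x * phi y], which depends on [x^2 + y^2] only. *)
Lemma iid_normal_rotation (E : set T) n (X : 'I_n -> T -> R) (c s : R) i j :
  measurable E -> i != j -> c ^+ 2 + s ^+ 2 = 1 -> iid_normal E X ->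
  iid_normal E (fun k t => pair_rotation c s i j (X^~ t) k).
Proof.
move=> mE ij cs [mX PX].
have ji : j != i by rewrite eq_sym.
have mXc k e : measurable_fun setT (fun t => e * X k t) by exact: measurable_funM.
split.
  move=> k; rewrite /pair_rotation; case: (k == i); first exact: measurable_funD.
  by case: (k == j) => //; exact: measurable_funB.
move=> B mB.
pose E' := [set t | E t /\ forall k, k != i -> k != j -> B k (X k t)].
pose q := (\prod_(k < n | (k != i) && (k != j)) N01 (B k))%E.
have PA A0 A1 : measurable A0 -> measurable A1 ->
    P [set t | [/\ E' t, A0 (X i t) & A1 (X j t)]] = (P E * (N01 A0 * N01 A1 * q))%E.
  move=> m0 m1.
  pose B' k := if k == i then A0 else if k == j then A1 else B k.
  have mB' k : measurable (B' k) by rewrite /B'; case: ifP => // _; case: ifP.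
  have := PX B' mB'.
  have B'i : B' i = A0 by rewrite /B' eqxx.
  have B'j : B' j = A1 by rewrite /B' ifN // eqxx.
  rewrite (bigD1 i)//= (bigD1 j)//= B'i B'j.
  rewrite (muleA (N01 A0)) (eq_bigr (fun k => N01 (B k))); last first.
    by move=> k /andP[ki kj]; rewrite /B' (negbTE ki) (negbTE kj).
  move=> <-; congr (P _); apply/seteqP; split => t /=.
    move=> [[Et Bt] Xi Xj]; split=> // k; rewrite /B'.
    case: eqVneq => [->//|ki]; case: eqVneq => [->//|kj]; exact: Bt.
  move=> [Et Bt]; split.
  - split=> // k ki kj; have := Bt k; by rewrite /B' (negbTE ki) (negbTE kj).
  - by have := Bt i; rewrite /B' eqxx.
  - by have := Bt j; rewrite /B' (negbTE ji) eqxx.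
have PE' : P E' = (P E * q)%E.
  have := PA setT setT measurableT measurableT; rewrite !probability_setT !mul1e => <-.
  by congr (P _); apply/seteqP; split => t /=; [split|move=> []].
have mXB k A : measurable A -> measurable [set t | A (X k t)].
  by move=> mA; rewrite -[X in measurable X]setTI; exact: (mX k).
have mE' : measurable E'.
  rewrite (_ : E' = E `&`
      \bigcap_(k in [set k | (k != i) && (k != j)]) [set t | B k (X k t)]); last first.
    apply/seteqP; split => t /= [Et Bt]; split=> //.
      by move=> k /andP[]; exact: Bt.
    by move=> k ki kj; apply: (Bt k); rewrite /= ki.
  apply: measurableI => //; apply: fin_bigcap_measurable; first exact: finite_finset.
  by move=> k _; exact: mXB.
pose C := [set z : R * R | B i (c * z.1 + s * z.2) /\ B j (c * z.2 - s * z.1)].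
have mzc : measurable_fun setT (fun z : R * R => c * z.1 + s * z.2).
  by apply: measurable_funD; apply: measurable_funM.
have mzs : measurable_fun setT (fun z : R * R => c * z.2 - s * z.1).
  by apply: measurable_funB; apply: measurable_funM.
have mC : measurable C.
  apply: measurableI; rewrite -[X in measurable X]setTI; [exact: mzc|exact: mzs].
have mphi := @measurable_normal_pdf R 0 1.
have phi0 := @normal_pdf_ge0 R 0 1.
transitivity (P [set t | E' t /\ C (X i t, X j t)]).
  congr (P _); apply/seteqP; split => t /=.
    move=> [Et Bt]; split; first split => //.
    - by move=> k ki kj; have := Bt k; rewrite /pair_rotation (negbTE ki) (negbTE kj).
    - split; first by have := Bt i; rewrite /pair_rotation eqxx.
      by have := Bt j; rewrite /pair_rotation (negbTE ji) eqxx.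
  move=> [[Et Bt] [Bi Bj]]; split=> // k; rewrite /pair_rotation.
  case: eqVneq => [->//|ki]; case: eqVneq => [->//|kj]; exact: Bt.
rewrite (@joint_density R phi phi) => //; last first.
  move=> A B0 mA mB0; rewrite PA// PE' -!muleA; congr (_ * _)%E.
  by rewrite muleA muleC.
rewrite PE' -muleA; congr (_ * _)%E.
rewrite (bigD1 i)//= (bigD1 j)//= muleA [RHS]muleC; congr (_ * _)%E.
apply: integral2_rotated_rectangle => // x y.
exact: normal_pdf_rotation.
Qed.

End gaussian_family.

Section normal_scaling.
Context {R : realType}.
Local Notation mu := (@lebesgue_measure R).

Lemma normal_pdf_scale (a s x : R) : 0 < s -> `|a| * s = 1 ->
  normal_pdf 0 s x = `|a| * normal_pdf 0 1 (a * x).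
Proof.
move=> s0 as1; have sn0 : s != 0 by rewrite gt_eqF.
have aE : `|a| = s^-1 by apply: (mulIf sn0); rewrite as1 mulVf.
have a2 : a ^+ 2 = (s ^+ 2)^-1 by rewrite -real_normK ?num_real// aE exprVn.
rewrite normal_pdf01E normal_pdfE// mulrA; congr (_ * _).
  rewrite /normal_peak -!mulrnAr expr1n mul1r sqrtrM ?sqr_ge0//.
  by rewrite sqrtr_sqr gtr0_norm// invfM aE.
by rewrite /normal_fun subr0 exprMn a2; congr expR; field.
Qed.

(** The sign of [a] is left free: besides the standardisation [a = s^-1], the lemma serves for the
    sign that remains when a unit vector is rotated onto an axis. *)
Lemma normal_prob_scale (a s : R) (B : set R) : 0 < s -> `|a| * s = 1 ->
  measurable B -> normal_prob 0 s [set x | B (a * x)] = normal_prob 0 1 B.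
Proof.
move=> s0 as1 mB.
have a0 : a != 0.
  by apply/eqP => a0; move: as1; rewrite a0 normr0 mul0r => /eqP; rewrite eq_sym oner_eq0.
pose f u := (\1_B u * normal_pdf 0 1 u)%:E.
have mphi := @measurable_normal_pdf R 0 1.
have phi0 := @normal_pdf_ge0 R 0 1.
have mf : measurable_fun setT f.
  by apply/measurable_EFinP; apply: measurable_funM => //; exact: measurable_indic.
have f0 u : (0 <= f u)%E by rewrite lee_fin mulr_ge0.
transitivity (\int[mu]_x f x)%E.
  rewrite (ge0_integral_affine 0 a0 mf f0) -ge0_integralZl//; last first.
    exact: (measurableT_comp mf (measurable_affine a 0)).
  rewrite /normal_prob [LHS]integral_mkcond; apply: eq_integral => x _.
  rewrite patchE /f addr0 -EFinM (normal_pdf_scale _ s0 as1) indicE.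
  case: ifPn => h; first by rewrite (_ : _ \in B) ?mul1r//; move: h; rewrite !inE.
  rewrite (_ : _ \in B = false) ?mul0r ?mulr0//; apply/negP => xB.
  by move/negP: h; apply; move: xB; rewrite !inE.
rewrite /normal_prob [RHS]integral_mkcond; apply: eq_integral => x _.
by rewrite patchE /f indicE; case: ifPn => _; rewrite ?mul1r// mul0r.
Qed.

End normal_scaling.

Section dot_product.
Context {R : realType}.

Definition dot n (u v : 'I_n -> R) : R := \sum_i u i * v i.

Lemma dot_pair_rotation (c s : R) n (i j : 'I_n) (u v : 'I_n -> R) : i != j ->
  c ^+ 2 + s ^+ 2 = 1 ->
  dot (pair_rotation c s i j u) (pair_rotation c s i j v) = dot u v.
Proof.
move=> ij cs; have ji : j != i by rewrite eq_sym.
rewrite /dot (bigD1 i)//= (bigD1 j)//= [RHS](bigD1 i)//= [in RHS](bigD1 j)//=.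
rewrite !addrA; congr (_ + _).
  rewrite /pair_rotation eqxx (negbTE ji) eqxx.
  transitivity ((c ^+ 2 + s ^+ 2) * (u i * v i + u j * v j)); first by ring.
  by rewrite cs mul1r.
by apply: eq_bigr => k /andP[ki kj]; rewrite /pair_rotation (negbTE ki) (negbTE kj).
Qed.

End dot_product.

(** * Orthonormal combinations of a standard Gaussian family *)

Section orthonormal_combinations.
Context {R : realType} d (T : measurableType d) (P : probability T R).

(** The inductive step behind both orthonormal combinations and sums of squares: a constraint on the
    first coordinate becomes part of the event, and the tail stays standard relative to it. *)
Lemma iid_normal_head (E : set T) n (X : 'I_n.+1 -> T -> R) (A : set R) :
  measurable E -> iid_normal P E X -> measurable A ->
  let E1 := [set t | E t /\ A (X ord0 t)] in
  [/\ measurable E1, P E1 = (P E * normal_prob 0 1 A)%E &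
      iid_normal P E1 (fun i => X (lift ord0 i))].
Proof.
move=> mE [mX PX] mA E1.
have PXl (B : 'I_n -> set R) : (forall i, measurable (B i)) ->
    P [set t | E1 t /\ forall i, B i (X (lift ord0 i) t)] =
    (P E * normal_prob 0 1 A * \prod_(i < n) normal_prob 0 1 (B i))%E.
  move=> mB.
  pose B' i := if unlift ord0 i is Some k then B k else A.
  have mB' i : measurable (B' i) by rewrite /B'; case: unlift.
  have := PX B' mB'.
  rewrite big_ord_recl /B' unlift_none muleA => PB.
  transitivity (P [set t | E t /\ forall i, B' i (X i t)]).
    congr (P _); apply/seteqP; split => t /=.
      move=> [[Et At] Bt]; split=> // i; rewrite /B'.
      by case: unliftP => [k ->|->].
    move=> [Et Bt]; split; first by split=> //; have := Bt ord0; rewrite /B' unlift_none.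
    by move=> i; have := Bt (lift ord0 i); rewrite /B' liftK.
  rewrite PB; congr (_ * _)%E; apply: eq_bigr => i _; by rewrite liftK.
have PE1 : P E1 = (P E * normal_prob 0 1 A)%E.
  have := PXl (fun=> setT) (fun=> measurableT).
  rewrite big1 ?mule1; last by move=> i _; rewrite probability_setT.
  by move=> <-; congr (P _); apply/seteqP; split => t /=; [|case].
split => //.
  by apply: measurableI => //; rewrite -[X in measurable X]setTI; exact: mX.
by split => // B mB; rewrite PE1 PXl.
Qed.

(** Givens elimination: the coordinates of [a] after the first are cleared one at a time. The
    composite [f] is kept abstract, as an isometry that also acts on Gaussian families. *)
Lemma rotate_to_axis n (a : 'I_n.+1 -> R) :
  exists f : ('I_n.+1 -> R) -> ('I_n.+1 -> R),
  [/\ forall u v, dot (f u) (f v) = dot u v,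
      forall E X, measurable E -> iid_normal P E X ->
        iid_normal P E (fun k t => f (X^~ t) k) &
      forall j, j != ord0 -> f a j = 0].
Proof.
have clear_upto m : (m <= n)%N -> exists f : ('I_n.+1 -> R) -> ('I_n.+1 -> R),
    [/\ forall u v, dot (f u) (f v) = dot u v,
        forall E X, measurable E -> iid_normal P E X ->
          iid_normal P E (fun k t => f (X^~ t) k) &
        forall j : 'I_n.+1, (0 < j <= m)%N -> f a j = 0]; last first.
  have [f [fdot fX fa]] := clear_upto n (leqnn n).
  exists f; split=> // j j0; apply: fa; rewrite -[(j <= n)%N]ltnS ltn_ord andbT lt0n.
  by apply: contra j0 => /eqP j0; apply/eqP/val_inj.
elim: m => [_|m IH mn].
  exists id; split=> // j; by case: (nat_of_ord j).
have [f [fdot fX fa]] := IH (ltnW mn).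
have [j jE] : exists j : 'I_n.+1, j = m.+1 :> nat by exists (Ordinal (mn : (m.+1 < n.+1)%N)).
have lastj (k : 'I_n.+1) : (0 < k <= m.+1)%N -> k != j -> (0 < k <= m)%N.
  move=> /andP[-> km] kj; rewrite -[(k <= m)%N]ltnS ltn_neqAle km andbT -jE.
  by apply: contra kj => /eqP kj; apply/eqP/val_inj.
(* An entry that is already zero is left alone; this ensures [r != 0] in the other case. *)
have [fj0|fj0] := eqVneq (f a j) 0.
  exists f; split=> // k km; have [->//|kj] := eqVneq k j.
  by apply: fa; exact: lastj kj.
have j0 : ord0 != j by rewrite -val_eqE/= jE.
pose p := f a ord0; pose q := f a j; pose r := Num.sqrt (p ^+ 2 + q ^+ 2).
have pq0 : 0 < p ^+ 2 + q ^+ 2 by rewrite ltr_wpDl ?sqr_ge0// exprn_even_gt0.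
have r2 : r ^+ 2 = p ^+ 2 + q ^+ 2 by rewrite sqr_sqrtr// ltW.
have r0 : r != 0 by rewrite gt_eqF// sqrtr_gt0.
have cs : (p / r) ^+ 2 + (q / r) ^+ 2 = 1.
  by rewrite !exprMn exprVn -mulrDl -r2 mulfV// expf_neq0.
(* The rotation with cosine [p / r] and sine [q / r] sends [(p, q)] to [(r, 0)]. *)
exists (fun v => pair_rotation (p / r) (q / r) ord0 j (f v)); split.
- by move=> u v; rewrite dot_pair_rotation.
- by move=> E X mE EX; apply: (iid_normal_rotation mE j0 cs (fX _ _ mE EX)).
- move=> k km; rewrite /pair_rotation.
  have -> : (k == ord0) = false by apply/negbTE; rewrite -val_eqE/= -lt0n; case/andP: km.
  have [_|kj] := eqVneq k j; first by rewrite -/p -/q; field.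
  by apply: fa; exact: lastj kj.
Qed.

(** Induction on the number of vectors. Once the first vector lies on the first axis, orthogonality
    confines the other ones to the remaining coordinates, where they are again orthonormal; the
    constraint on the first combination goes into the event. *)
Lemma iid_normal_orthonormal k n (E : set T) (X : 'I_n -> T -> R)
    (a : 'I_k -> 'I_n -> R) :
  measurable E -> iid_normal P E X ->
  (forall i j, dot (a i) (a j) = (i == j)%:R) ->
  iid_normal P E (fun i t => dot (a i) (X^~ t)).
Proof.
elim: k n E X a => [|k IH] n E X a mE EX aa.
  split=> [[]//|B _]; rewrite big_ord0 mule1; congr (P _).
  by apply/seteqP; split => t /=; [case|split=> // -[]].
case: n X a EX aa => [|n] X a EX aa.
  by have := aa ord0 ord0; rewrite eqxx /dot big_ord0 => /eqP; rewrite eq_sym oner_eq0.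
have [f [fdot fX fa]] := rotate_to_axis (a ord0).
pose Y i t := f (X^~ t) i.
have EY : iid_normal P E Y := fX _ _ mE EX.
(* [e] is the only nonzero entry of the rotated unit vector, hence a sign. *)
pose e := f (a ord0) ord0.
have dotf0 v : dot (f (a ord0)) v = e * v ord0.
  rewrite /dot (bigD1 ord0)//= big1 ?addr0// => i i0.
  by rewrite fa ?mul0r.
have e2 : e ^+ 2 = 1 by rewrite expr2 -dotf0 fdot aa eqxx.
have e1 : `|e| = 1.
  by apply/eqP; rewrite -sqrp_eq1// real_normK ?num_real// e2.
have e0 : e != 0 by rewrite -normr_eq0 e1 oner_eq0.
(* [e] times this entry is the dot product with the first rotated vector, which vanishes. *)
have fi0 i : f (a (lift ord0 i)) ord0 = 0.
  apply: (mulfI e0); rewrite -dotf0 fdot aa mulr0.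
  by rewrite (_ : ord0 == _ = false)//; apply/negbTE/neq_lift.
pose b i j := f (a (lift ord0 i)) (lift ord0 j).
have dotb i v : dot (f (a (lift ord0 i))) v = dot (b i) (fun j => v (lift ord0 j)).
  by rewrite /dot big_ord_recl fi0 mul0r add0r.
have bb i j : dot (b i) (b j) = (i == j)%:R.
  by rewrite -dotb fdot aa (inj_eq lift_inj).
have aX0 t : dot (a ord0) (X^~ t) = e * Y ord0 t by rewrite -fdot dotf0.
have aXl i t : dot (a (lift ord0 i)) (X^~ t) = dot (b i) (fun j => Y (lift ord0 j) t).
  by rewrite -fdot dotb.
split.
  move=> i; apply: measurable_sum => j; apply: measurable_funM => //.
  by have [mX _] := EX; exact: mX.
move=> B mB.
pose A := [set y | B ord0 (e * y)].
have mA : measurable A.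
  rewrite -[X in measurable X]setTI; apply: (measurable_funM _ _ _ (mB ord0)) => //.
have [mE1 PE1 EY1] := iid_normal_head mE EY mA.
have [_ IHB] := IH _ _ _ _ mE1 EY1 bb.
have := IHB (fun i => B (lift ord0 i)) (fun i => mB _).
rewrite PE1 normal_prob_scale ?e1 ?mul1r// big_ord_recl muleA => <-.
congr (P _); apply/seteqP; split => t /=.
  move=> [Et Bt]; split; first by split=> //; have := Bt ord0; rewrite aX0.
  by move=> i; rewrite -aXl; exact: Bt.
move=> [[Et At] Bt]; split=> // i; have [->|[j ->]] : i = ord0 \/ exists j, i = lift ord0 j.
- by case: (unliftP ord0 i) => [j ->|->]; [right; exists j|left].
- by rewrite aX0.
- by rewrite aXl; exact: Bt.
Qed.

End orthonormal_combinations.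

(** * Integrals of a function of the square *)

Section squared_variable.
Context {R : realType}.
Local Notation mu := (@lebesgue_measure R).
Local Open Scope ereal_scope.

(** Discarding the null point [y = 0] makes division by [y^2] legitimate in the proof of
    proportionality that follows. *)
Lemma integral_sqr_neq0 (f : R -> \bar R) :
  measurable_fun setT f ->
  \int[mu]_y f (y ^+ 2)%R = \int[mu]_y (if (y ^+ 2 == 0)%R then 0 else f (y ^+ 2)%R).
Proof.
move=> mf.
have mf2 : measurable_fun setT (fun y : R => f (y ^+ 2)%R).
  by apply: (measurableT_comp mf); exact: measurable_funX.
rewrite -(@integral_setD1 _ _ 0%R)//; last 2 first.
- by apply: measurableD => //; exact: measurable_set1.
- exact: measurable_funTS.
rewrite integral_mkcond; apply: eq_integral => y _.
rewrite patchE sqrf_eq0; case: ifPn => [|/negP]; rewrite inE /=.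
  by move=> [_ /eqP]; case: eqP.
by move=> y0; case: eqVneq => // /eqP yn0; exfalso; apply: y0; split.
Qed.

(* Replacing [f] with [fun x => f (a * x)] multiplies both sides by [a^(-1/2)],
   which forces proportionality: integrate [h x * f (y^2 * x)] in the two
   possible orders, with [h x = sqrt x] on ]0, 1] and 0 elsewhere. *)
Lemma ge0_integral_sqr : exists2 c : \bar R, 0 <= c &
  forall f : R -> \bar R, measurable_fun setT f -> (forall x, 0 <= f x) ->
  \int[mu]_y f (y ^+ 2)%R =
  c * \int[mu]_x ((if 0 < x then x `^ (- 2^-1) else 0)%R%:E * f x).
Proof.
pose h (x : R) : R := (if 0 < x <= 1 then x `^ 2^-1 else 0)%R.
(* This is [1 / y^2], with value 0 at [y = 0]. *)
pose yi (y : R) : R := ((y ^+ 2) `^ (-1))%R.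
have h0 x : (0 <= h x)%R by rewrite /h; case: ifP => // _; exact: powR_ge0.
have yi0 y : (0 <= yi y)%R by exact: powR_ge0.
have mh : measurable_fun setT h.
  apply: measurable_fun_ifT => //.
  by apply: measurable_and; [exact: measurable_fun_ltr|exact: measurable_fun_ler].
have myi : measurable_fun setT yi.
  by apply: (measurableT_comp (measurable_powR _)); exact: measurable_funX.
have [B BE] : exists B, B = \int[mu]_y (yi y * h (yi y))%:E by eexists.
exists B; first by rewrite BE; apply: integral_ge0 => y _; rewrite lee_fin mulr_ge0.
move=> f mf f0; rewrite integral_sqr_neq0//.
pose g (x : R) : \bar R := if (x == 0)%R then 0 else f x.
have mg : measurable_fun setT g.
  by apply: measurable_fun_ifT => //; exact: measurable_fun_eqr.
have g0 x : 0 <= g x by rewrite /g; case: ifP.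
transitivity (\int[mu]_y g (y ^+ 2)%R) => [//|].
have -> : \int[mu]_x ((if 0 < x then x `^ (- 2^-1) else 0)%R%:E * f x) =
    \int[mu]_x ((if 0 < x then x `^ (- 2^-1) else 0)%R%:E * g x).
  apply: eq_integral => x _; rewrite /g; have [->|//] := eqVneq x 0%R.
  by rewrite ltxx !mul0e.
have gz : g 0%R = 0 by rewrite /g eqxx.
(* Rescaling [y] by [sqrt x] shows that the inner integral does not depend on [x] in []0, 1]]; the
   interval has length 1. *)
have I1 : \int[mu]_x \int[mu]_y ((h x)%:E * g (y ^+ 2 * x)%R) = \int[mu]_y g (y ^+ 2)%R.
  transitivity (\int[mu]_x ((\1_(`]0%R, 1%R]%classic) x)%:E * \int[mu]_y g (y ^+ 2)%R)).
    apply: eq_integral => x _; rewrite /h indicE.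
    have mgx : measurable_fun setT (fun y : R => g (y ^+ 2 * x)%R).
      by apply: (measurableT_comp mg); apply: measurable_funM => //; exact: measurable_funX.
    rewrite ge0_integralZl//; last by rewrite lee_fin; exact: h0.
    have -> : (x \in `]0%R, 1%R]%classic) = (0 < x <= 1)%R by rewrite mem_setE in_itv.
    case: ifPn => [/andP[x0 x1]|_]; last by rewrite !mul0e.
    have xs : (x `^ 2^-1 != 0)%R by rewrite gt_eqF// powR_gt0.
    rewrite mul1e (ge0_integral_affine 0 xs (f := fun y => g (y ^+ 2)%R))//; last first.
      by apply: (measurableT_comp mg); exact: measurable_funX.
    rewrite ger0_norm ?powR_ge0//; congr (_ * _); apply: eq_integral => y _.
    by congr g; rewrite addr0 exprMn powR12_sqrt ?(ltW x0)// sqr_sqrtr ?(ltW x0)// mulrC.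
  rewrite ge0_integralZr//; last 2 first.
  - by apply/measurable_EFinP; exact: measurable_indic.
  - by apply: integral_ge0.
  by rewrite integral_indic//= setIT lebesgue_measure_itv/= lte01 oppr0 adde0 mul1e.
have mhg : measurable_fun setT (fun z : R * R => (h z.1)%:E * g (z.2 ^+ 2 * z.1)%R).
  apply: emeasurable_funM.
    by apply/measurable_EFinP; exact: measurableT_comp.
  apply: (measurableT_comp mg); apply: measurable_funM => //.
  by apply: measurable_funX.
have hg0 x y : 0 <= (h x)%:E * g (y ^+ 2 * x)%R by rewrite mule_ge0// lee_fin.
rewrite -I1 (@tonelli2 R (fun x y => (h x)%:E * g (y ^+ 2 * x)%R) mhg hg0).
(* The integrand after [x] is replaced by [x / y^2], Jacobian included; [x] now enters [g] without
   [y]. *)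
pose k (y x : R) := (yi y * h (yi y * x))%:E * g x.
have mk : measurable_fun setT (fun z : R * R => k z.1 z.2).
  apply: emeasurable_funM; last exact: (measurableT_comp mg).
  apply/measurable_EFinP; apply: measurable_funM; first exact: (measurableT_comp myi).
  by apply: (measurableT_comp mh); apply: measurable_funM => //; exact: (measurableT_comp myi).
have k0 y x : 0 <= k y x by rewrite mule_ge0// lee_fin mulr_ge0.
have mky y : measurable_fun setT (k y).
  apply: emeasurable_funM => //; apply/measurable_EFinP; apply: measurable_funM => //.
  by apply: (measurableT_comp mh); exact: measurable_funM.
transitivity (\int[mu]_y \int[mu]_x k y x).
  apply: eq_integral => y _; have [->|y0] := eqVneq y 0%R.
    rewrite integral0_eq; last by move=> x _; rewrite expr0n/= mul0r gz mule0.
    rewrite integral0_eq// => x _.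
    by rewrite /k /yi expr0n/= powR0 ?mul0r ?mul0e// oppr_eq0 oner_eq0.
  have y20 : (y ^+ 2 != 0)%R by rewrite sqrf_eq0.
  have yiE : (yi y = (y ^+ 2)^-1)%R by rewrite /yi powR_inv1// sqr_ge0.
  rewrite (ge0_integral_affineZ 0 y20 (mky y) (k0 y)).
  apply: eq_integral => x _; rewrite /k addr0 ger0_norm ?sqr_ge0// yiE muleA -EFinM.
  by rewrite (mulKf y20) (mulVKf y20).
rewrite (@tonelli2 R k mk k0).
rewrite -ge0_integralZl//; last 3 first.
- apply: emeasurable_funM => //; apply/measurable_EFinP; apply: measurable_fun_ifT => //.
  exact: measurable_fun_ltr.
- by move=> x _; rewrite mule_ge0// lee_fin; case: ifP => // _; exact: powR_ge0.
- by rewrite BE; apply: integral_ge0 => y _; rewrite lee_fin mulr_ge0.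
apply: eq_integral => x _.
have [x0|x0] := ltP 0%R x; last first.
  rewrite mul0e mule0 integral0_eq// => y _; rewrite /k /h.
  rewrite ifN ?mulr0 ?mul0e// negb_and -leNgt; apply/orP; left.
  exact: mulr_ge0_le0.
have xs : (x `^ 2^-1 != 0)%R by rewrite gt_eqF// powR_gt0.
have mw : measurable_fun setT (fun y => (yi y * h (yi y * x))%:E).
  apply/measurable_EFinP; apply: measurable_funM => //.
  by apply: (measurableT_comp mh); apply: measurable_funM.
have w0 y : 0 <= (yi y * h (yi y * x))%:E by rewrite lee_fin mulr_ge0.
have -> : \int[mu]_y k y x = \int[mu]_y (yi y * h (yi y * x))%:E * g x.
  by apply: ge0_integralZr => //.
rewrite (muleA B).
(* Rescaling [y] by [sqrt x] brings the Jacobian [sqrt x] and a factor [1 / x] from [yi], and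
   removes [x] from the argument of [h]. *)
suff -> : \int[mu]_y (yi y * h (yi y * x))%:E = B * (x `^ (- 2^-1))%:E by [].
have mB : measurable_fun setT (fun y => (yi y * h (yi y))%:E).
  by apply/measurable_EFinP; apply: measurable_funM => //; exact: (measurableT_comp mh).
have B0 y : 0 <= (yi y * h (yi y))%:E by rewrite lee_fin mulr_ge0.
have x20 : 0 <= (x `^ (- 2^-1))%:E by rewrite lee_fin powR_ge0.
rewrite (ge0_integral_affineZ 0 xs mw w0) [RHS]muleC BE.
have <- : \int[mu]_y ((x `^ (- 2^-1))%:E * (yi y * h (yi y))%:E) =
    (x `^ (- 2^-1))%:E * \int[mu]_y (yi y * h (yi y))%:E by rewrite ge0_integralZl.
apply: eq_integral => y _; rewrite -!EFinM addr0.
have -> : yi (x `^ 2^-1 * y)%R = (x^-1 * yi y)%R.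
  rewrite /yi exprMn powRM ?sqr_ge0//; congr (_ * _)%R.
  by rewrite powR12_sqrt ?(ltW x0)// sqr_sqrtr ?(ltW x0)// powR_inv1 ?(ltW x0).
have -> : (x^-1 * yi y * x = yi y)%R by rewrite mulrAC mulVf ?mul1r// gt_eqF.
rewrite ger0_norm ?powR_ge0// !mulrA; congr (_ * _ * _)%:E.
rewrite -[(x^-1)%R]powR_inv1 ?(ltW x0)// -powRD; last by rewrite (gt_eqF x0) implybT.
by congr (_ `^ _)%R; field.
Qed.

End squared_variable.

(** * Gamma densities and the law of a sum of squares *)

Section gamma_kernel.
Context {R : realType}.
Local Notation mu := (@lebesgue_measure R).
Local Notation phi := (@normal_pdf R 0 1).

(** Unnormalised gamma density of shape [p] and rate 1/2; [p = n / 2] is chi-square with [n] degrees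
    of freedom. *)
Definition gamma_kernel (p x : R) : R :=
  if 0 < x then x `^ (p - 1) * expR (- x / 2) else 0.

Lemma gamma_kernel_ge0 p x : 0 <= gamma_kernel p x.
Proof.
by rewrite /gamma_kernel; case: ifP => // _; rewrite mulr_ge0 ?powR_ge0 ?expR_ge0.
Qed.

Lemma measurable_gamma_kernel p : measurable_fun setT (gamma_kernel p).
Proof.
apply: measurable_fun_ifT => //; first exact: measurable_fun_ltr.
apply: measurable_funM => //; apply: measurableT_comp => //.
by apply: measurable_funM => //; exact: measurable_funN.
Qed.

Lemma measurable_gamma_kernel_comp d (T : measurableType d) p (f : T -> R) :
  measurable_fun setT f -> measurable_fun setT (fun x => gamma_kernel p (f x)).
Proof. exact: (measurableT_comp (measurable_gamma_kernel p)). Qed.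

(** An infinite [c] would give a product 0 or [+oo]. This is how total mass 1 makes a constant
    finite. *)
Lemma mule_eq1_fin (c a : \bar R) : (0 <= c)%E -> (0 <= a)%E -> (c * a = 1)%E ->
  exists2 C : R, 0 <= C & c = C%:E.
Proof.
case: c => [C|_|//]; first by move=> C0 _ _; exists C.
rewrite le_eqVlt => /predU1P[<-|a0]; first by rewrite mule0 => -[] /eqP; rewrite eq_sym oner_eq0.
by rewrite gt0_mulye.
Qed.

Local Open Scope ereal_scope.

(** For [y > 0], substituting [x = y t] makes the exponentials independent of [t] and pulls out
    [y^(p+q-1)]. The constant is the beta integral of [b], which may be infinite for arbitrary [p]
    and [q]. *)
Lemma gamma_convolution (p q : R) : exists2 c : \bar R, 0 <= c &
  forall y, \int[mu]_x (gamma_kernel p (y - x) * gamma_kernel q x)%:E =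
            c * (gamma_kernel (p + q) y)%:E.
Proof.
pose b (t : R) : R :=
  (if (0 < t) && (t < 1) then (1 - t) `^ (p - 1) * t `^ (q - 1) else 0)%R.
have b0 t : (0 <= b t)%R by rewrite /b; case: ifP => // _; rewrite mulr_ge0 ?powR_ge0.
have mb : measurable_fun setT b.
  apply: measurable_fun_ifT => //.
    by apply: measurable_and; exact: measurable_fun_ltr.
  apply: measurable_funM => //; apply: (measurableT_comp (measurable_powR _)).
  exact: measurable_funB.
exists (\int[mu]_t (b t)%:E); first by apply: integral_ge0 => t _; rewrite lee_fin.
move=> y; have [y0|y0] := ltP 0%R y; last first.
  rewrite /gamma_kernel [in RHS]ifN -?leNgt// mule0 integral0_eq// => x _.
  have [yx|yx] := ltP x y; last by rewrite [in X in (X * _)%R]ifN ?mul0r// -leNgt subr_le0.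
  by rewrite [in X in (_ * X)%R]ifN ?mulr0// -leNgt (le_trans (ltW yx)).
have yn0 : y != 0%R by rewrite gt_eqF.
rewrite (ge0_integral_affineZ 0 yn0); last 2 first.
- apply/measurable_EFinP; apply: measurable_funM; last exact: measurable_gamma_kernel.
  by apply: measurable_gamma_kernel_comp; exact: measurable_funB.
- by move=> x; rewrite lee_fin mulr_ge0 ?gamma_kernel_ge0.
have gk0 := gamma_kernel_ge0 (p + q) y.
rewrite -ge0_integralZr//; last 2 first.
- exact/measurable_EFinP.
- by move=> t _; rewrite lee_fin.
apply: eq_integral => t _; rewrite addr0 -!EFinM gtr0_norm//; congr _%:E.
have -> : (y - y * t = y * (1 - t))%R by rewrite mulrBr mulr1.
rewrite /b /gamma_kernel y0 !pmulr_rgt0// subr_gt0.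
case: (ltP t 1%R) => t1; last by rewrite andbF !mul0r mulr0.
case: (ltP 0%R t) => t0; last by rewrite !(mul0r, mulr0).
rewrite /= !powRM ?subr_ge0 ?(ltW y0) ?(ltW t0) ?(ltW t1)//.
have -> : (y `^ (p + q - 1) = y * (y `^ (p - 1) * y `^ (q - 1)))%R.
  rewrite -powRD ?yn0 ?implybT// -{2}[y]powRr1 ?(ltW y0)// -powRD ?yn0 ?implybT//.
  by congr (_ `^ _)%R; ring.
have -> : (expR (- y / 2) = expR (- (y * (1 - t)) / 2) * expR (- (y * t) / 2))%R.
  by rewrite -expRD; congr expR; field.
by ring.
Qed.

(** The normal density is itself a function of [y^2], so it can be absorbed into the test function
    of [ge0_integral_sqr]; the test function 1 then shows that the constant is finite. *)
Lemma normal_sqr : exists2 C : R, (0 <= C)%R &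
  forall f : R -> \bar R, measurable_fun setT f -> (forall x, 0 <= f x) ->
  \int[mu]_y (f (y ^+ 2)%R * (phi y)%:E) =
  \int[mu]_x ((C * gamma_kernel 2^-1 x)%:E * f x).
Proof.
have [c c0 cE] := @ge0_integral_sqr R.
have mgk := measurable_gamma_kernel 2^-1.
have p0 : (0 <= @normal_peak R 1)%R by exact: normal_peak_ge0.
have pgk0 x : (0 <= normal_peak 1 * gamma_kernel 2^-1 x)%R.
  by rewrite mulr_ge0 ?gamma_kernel_ge0.
have key (f : R -> \bar R) : measurable_fun setT f -> (forall x, 0 <= f x) ->
    \int[mu]_y (f (y ^+ 2)%R * (phi y)%:E) =
    c * \int[mu]_x ((normal_peak 1 * gamma_kernel 2^-1 x)%:E * f x).
  move=> mf f0; pose F x := f x * (normal_peak 1 * expR (- x / 2))%:E.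
  have mF : measurable_fun setT F.
    apply: emeasurable_funM => //; apply/measurable_EFinP; apply: measurable_funM => //.
    by apply: measurableT_comp => //; apply: measurable_funM => //; exact: measurable_funN.
  have F0 x : 0 <= F x by rewrite mule_ge0// lee_fin mulr_ge0 ?expR_ge0.
  have := cE F mF F0.
  rewrite (_ : \int[mu]_y F (y ^+ 2)%R = \int[mu]_y (f (y ^+ 2)%R * (phi y)%:E)); last first.
    by apply: eq_integral => y _; rewrite /F normal_pdf01E.
  move=> ->; congr (_ * _); apply: eq_integral => x _; rewrite /F /gamma_kernel.
  case: ifP => _; last by rewrite mulr0 !mul0e.
  rewrite muleCA muleC -EFinM; congr (_%:E * _).
  by rewrite (_ : - 2^-1 = 2^-1 - 1)%R; [ring|field].
have tot : c * \int[mu]_x (normal_peak 1 * gamma_kernel 2^-1 x)%:E = 1.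
  have := key (cst 1) (measurable_cst _) (fun=> lee01).
  under eq_integral do rewrite mul1e.
  rewrite integral_normal_pdf => ->; congr (_ * _).
  by apply: eq_integral => x _; rewrite mule1.
have [C C0 CE] : exists2 C, (0 <= C)%R & c = C%:E.
  by apply: (mule_eq1_fin c0 _ tot); apply: integral_ge0 => x _; rewrite lee_fin.
exists (C * normal_peak 1)%R; first by rewrite mulr_ge0.
move=> f mf f0; rewrite key// CE -ge0_integralZl//.
- by apply: eq_integral => x _; rewrite muleA -EFinM mulrA.
- apply: emeasurable_funM => //; apply/measurable_EFinP; exact: measurable_funM.
- by move=> x _; rewrite mule_ge0// lee_fin.
Qed.

(** The square has a gamma density of shape 1/2, and the translation [z = x + y] turns the law of
    the sum into a convolution of two gamma kernels. *)
Lemma gamma_add_normal_sqr (p C : R) : (0 <= C)%R ->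
  \int[mu]_x (C * gamma_kernel p x)%:E = 1 ->
  exists C' : R, [/\ (0 <= C')%R,
    \int[mu]_x (C' * gamma_kernel (p + 2^-1) x)%:E = 1 &
    forall D, measurable D ->
      \int[mu]_x \int[mu]_y
        (\1_[set z : R * R | D (z.1 ^+ 2 + z.2)%R] (x, y) *
         (phi x * (C * gamma_kernel p y)))%:E =
      \int[mu]_(x in D) (C' * gamma_kernel (p + 2^-1) x)%:E].
Proof.
move=> C0 tot.
have [C1 C10 C1E] := normal_sqr.
have [c c0 cE] := gamma_convolution 2^-1 p.
have mphi := @measurable_normal_pdf R 0 1.
have phi0 := @normal_pdf_ge0 R 0 1.
have mgk q := measurable_gamma_kernel q.
have gk0 := gamma_kernel_ge0.
pose e := c * (C1 * C)%:E.
have e0 : 0 <= e by rewrite mule_ge0// lee_fin mulr_ge0.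
have mgp : measurable_fun setT (fun x => (gamma_kernel (p + 2^-1) x)%:E).
  by apply/measurable_EFinP.
have key D : measurable D ->
    \int[mu]_x \int[mu]_y
      (\1_[set z : R * R | D (z.1 ^+ 2 + z.2)%R] (x, y) *
       (phi x * (C * gamma_kernel p y)))%:E =
    e * \int[mu]_(x in D) (gamma_kernel (p + 2^-1) x)%:E.
  move=> mD.
  have mi : measurable_fun setT (\1_D : R -> R) by exact: measurable_indic.
  have i0 x : (0 <= \1_D x :> R)%R by [].
  transitivity (\int[mu]_x \int[mu]_y
      (\1_D (x ^+ 2 + y)%R * (C * gamma_kernel p y) * phi x)%:E).
    apply: eq_integral => x _; apply: eq_integral => y _; congr _%:E.
    by rewrite [RHS]mulrAC !indicE -mulrA.
  rewrite (@tonelli2 R (fun x y =>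
    (\1_D (x ^+ 2 + y)%R * (C * gamma_kernel p y) * phi x)%:E)); first last.
  - by move=> x y; rewrite lee_fin !mulr_ge0.
  - apply/measurable_EFinP; apply: measurable_funM; last exact: measurableT_comp.
    apply: measurable_funM.
      apply: (measurableT_comp mi); apply: measurable_funD => //.
      exact: measurable_funX.
    by apply: measurable_funM => //; exact: measurable_gamma_kernel_comp.
  transitivity (\int[mu]_y \int[mu]_z
      (\1_D z * (C1 * C) * (gamma_kernel 2^-1 (z - y) * gamma_kernel p y))%:E).
    apply: eq_integral => y _.
    have mfy : measurable_fun setT (fun z : R => (\1_D (z + y)%R * (C * gamma_kernel p y))%:E).
      apply/measurable_EFinP; apply: measurable_funM => //.
      by apply: (measurableT_comp mi); exact: measurable_funD.
    have fy0 (z : R) : 0 <= (\1_D (z + y)%R * (C * gamma_kernel p y))%:E.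
      by rewrite lee_fin !mulr_ge0.
    transitivity (\int[mu]_x ((\1_D (x ^+ 2 + y)%R * (C * gamma_kernel p y))%:E * (phi x)%:E)).
      by apply: eq_integral => x _; rewrite EFinM.
    rewrite (C1E _ mfy fy0) (ge0_integral_affineZ (- y)%R (oner_neq0 _)); last 2 first.
    - apply: emeasurable_funM => //; apply/measurable_EFinP.
      by apply: measurable_funM.
    - by move=> x; rewrite mule_ge0// lee_fin mulr_ge0.
    apply: eq_integral => z _; rewrite normr1 !mul1r mul1e subrK -EFinM.
    by congr _%:E; ring.
  rewrite (@tonelli2 R (fun y z => (\1_D z * (C1 * C) *
    (gamma_kernel 2^-1 (z - y) * gamma_kernel p y))%:E)); first last.
  - by move=> x y; rewrite lee_fin mulr_ge0 ?(mulr_ge0 C10 C0)// ?mulr_ge0//.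
  - apply/measurable_EFinP; apply: measurable_funM.
      by apply: measurable_funM => //; exact: (measurableT_comp mi).
    apply: measurable_funM; apply: measurable_gamma_kernel_comp => //.
    exact: measurable_funB.
  pose gD := (fun x => (gamma_kernel (p + 2^-1) x)%:E) \_ D.
  have mgD : measurable_fun setT gD.
    apply/(measurable_restrictT (fun x => (gamma_kernel (p + 2^-1) x)%:E)) => //.
    exact: measurable_funTS.
  have gD0 x : 0 <= gD x by rewrite /gD patchE; case: ifP => // _; rewrite lee_fin.
  rewrite [in RHS]integral_mkcond -/gD -ge0_integralZl//.
  apply: eq_integral => z _.
  transitivity ((\1_D z * (C1 * C))%:E *
      \int[mu]_y (gamma_kernel 2^-1 (z - y) * gamma_kernel p y)%:E).
    rewrite -ge0_integralZl//.
    - by apply/measurable_EFinP; apply: measurable_funM; [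
        apply: measurable_gamma_kernel_comp; exact: measurable_funB|exact: mgk].
    - by move=> y _; rewrite lee_fin mulr_ge0.
    - by rewrite lee_fin !mulr_ge0.
  rewrite cE (addrC 2^-1%R) /gD patchE indicE; case: ifPn => _.
    by rewrite mul1r muleCA muleA.
  by rewrite mul0r mul0e mule0.
(* For [D = setT] the double integral is the total mass of a product of two probability
   densities. *)
have etot : e * \int[mu]_x (gamma_kernel (p + 2^-1) x)%:E = 1.
  have mk2 : measurable_fun setT (fun x => C * gamma_kernel p x)%R.
    exact: measurable_funM.
  have k20 x : (0 <= C * gamma_kernel p x)%R by rewrite mulr_ge0.
  have := integral2_rectangle mphi mk2 phi0 k20 measurableT measurableT.
  rewrite tot integral_normal_pdf mule1 => <-; rewrite -(key _ measurableT).
  by apply: eq_integral => x _; apply: eq_integral => y _; rewrite setXTT !indicT.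
have [C' C'0 C'E] : exists2 C', (0 <= C')%R & e = C'%:E.
  by apply: (mule_eq1_fin e0 _ etot); apply: integral_ge0 => x _; rewrite lee_fin.
have C'I D : measurable D -> \int[mu]_(x in D) (C' * gamma_kernel (p + 2^-1) x)%:E =
    e * \int[mu]_(x in D) (gamma_kernel (p + 2^-1) x)%:E.
  move=> mD; rewrite C'E -ge0_integralZl//; last 2 first.
  - exact: measurable_funTS.
  - by move=> x _; rewrite lee_fin.
exists C'; split; [exact: C'0|by rewrite C'I|move=> D mD].
by rewrite (key _ mD) (C'I _ mD).
Qed.

End gamma_kernel.

Section sum_of_squares.
Context {R : realType} d (T : measurableType d) (P : probability T R).
Local Notation mu := (@lebesgue_measure R).
Local Open Scope ereal_scope.

(** [C] is chosen before [E] and [X], since the induction hypothesis is applied to the tail with the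
    first coordinate moved into the event. The index is [n.+1] because an empty sum has no
    density. *)
Lemma sum_sqr_law n : exists C : R, [/\ (0 <= C)%R,
  \int[mu]_x (C * gamma_kernel (n.+1%:R / 2) x)%:E = 1 &
  forall E (X : 'I_n.+1 -> T -> R) D, measurable E -> iid_normal P E X -> measurable D ->
    P [set t | E t /\ D (\sum_i X i t ^+ 2)%R] =
    P E * \int[mu]_(x in D) (C * gamma_kernel (n.+1%:R / 2) x)%:E].
Proof.
have mphi := @measurable_normal_pdf R 0 1.
have phi0 := @normal_pdf_ge0 R 0 1.
elim: n => [|n [C [C0 tot IH]]].
  have [C C0 CE] := @normal_sqr R; rewrite div1r.
  have CI (D : set R) : measurable D ->
      \int[mu]_(y in [set y | D (y ^+ 2)%R]) (normal_pdf 0 1 y)%:E =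
      \int[mu]_(x in D) (C * gamma_kernel 2^-1 x)%:E.
    move=> mD; have CE' := CE (fun x => (\1_D x)%:E).
    rewrite [LHS]integral_mkcond [RHS]integral_mkcond.
    transitivity (\int[mu]_y ((\1_D (y ^+ 2)%R)%:E * (normal_pdf 0 1 y)%:E)).
      apply: eq_integral => y _; rewrite patchE indicE.
      case: ifPn => yD; first by rewrite mem_set ?mul1e//; move: yD; rewrite inE.
      by rewrite memNset ?mul0e//; move/negP: yD => yD Dy; apply: yD; rewrite inE.
    rewrite CE'//; last first.
      by apply/measurable_EFinP; exact: measurable_indic.
    apply: eq_integral => x _; rewrite patchE indicE.
    by case: ifP => _; rewrite ?mule1 ?mule0.
  exists C; split=> //.
    by rewrite -CI// -[RHS](@integral_normal_pdf R 0 1).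
  move=> E X D mE EX mD.
  have mA : measurable [set y : R | D (y ^+ 2)%R].
    rewrite -[X in measurable X]setTI; exact: (measurable_funX 2 (@measurable_id _ _ setT)).
  have [_ PE1 _] := iid_normal_head mE EX mA; rewrite -CI//.
  rewrite -[RHS]/(P E * normal_prob 0 1 [set y | D (y ^+ 2)%R]) -PE1.
  by congr (P _); apply/seteqP; split => t /=; rewrite big_ord_recl big_ord0 addr0.
have [C' [C'0 tot' C'E]] := gamma_add_normal_sqr C0 tot.
have pE : (n.+2%:R / 2 = n.+1%:R / 2 + 2^-1 :> R)%R.
  by rewrite -[n.+2]addn1 natrD mulrDl div1r.
rewrite pE; exists C'; split=> // E X D mE EX mD.
have [mX _] := EX.
pose S t := (\sum_(i < n.+1) X (lift ord0 i) t ^+ 2)%R.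
have mS : measurable_fun setT S.
  by apply: measurable_sum => i; apply: measurable_funX.
transitivity (P [set t | E t /\ [set z : R * R | D (z.1 ^+ 2 + z.2)%R] (X ord0 t, S t)]).
  by congr (P _); apply/seteqP; split => t /=; rewrite big_ord_recl.
rewrite (@joint_density R (normal_pdf 0 1) (fun x => C * gamma_kernel (n.+1%:R / 2) x)%R)//.
- by rewrite C'E.
- by apply: measurable_funM => //; exact: measurable_gamma_kernel.
- by move=> x; rewrite mulr_ge0// gamma_kernel_ge0.
- move=> A B mA mB; have [mE1 PE1 EX1] := iid_normal_head mE EX mA.
  rewrite muleA -PE1 -(IH _ _ _ mE1 EX1 mB).
  by congr (P _); apply/seteqP; split => t /=; [case|move=> [[]]].
- rewrite -[X in measurable X]setTI.
  have mf : measurable_fun setT (fun z : R * R => z.1 ^+ 2 + z.2)%R.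
    by apply: measurable_funD => //; exact: measurable_funX.
  exact: mf.
Qed.

End sum_of_squares.

(** * The ratio of two gamma variables and the F distribution *)

Section gamma_ratio.
Context {R : realType}.
Local Notation mu := (@lebesgue_measure R).

(** Unnormalised beta prime density with both parameters equal to [p]. *)
Definition beta_prime_kernel (p t : R) : R := t `^ (p - 1) * (1 + t) `^ (- (p + p)).

Lemma beta_prime_kernel_ge0 p t : 0 <= beta_prime_kernel p t.
Proof. by rewrite mulr_ge0 ?powR_ge0. Qed.

Lemma measurable_beta_prime_kernel p : measurable_fun setT (beta_prime_kernel p).
Proof.
apply: measurable_funM => //; apply: (measurableT_comp (measurable_powR _)).
exact: measurable_funD.
Qed.

Lemma F_kernel_diag (n : nat) (t : R) : (0 < n)%N ->
  F_kernel n n t = beta_prime_kernel (n%:R / 2) t.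
Proof.
move=> n0; rewrite /F_kernel /beta_prime_kernel natrD mulrDl.
by rewrite [n%:R * t]mulrC mulfK// pnatr_eq0 -lt0n.
Qed.

(** The leading [b] is the Jacobian of [a = b t]. The right side depends on [b] only through
    [(1 + t) * b], ready for integration over [b]. *)
Lemma gamma_kernel_scaled (p b t : R) : 0 < b -> 0 < t ->
  b * (gamma_kernel p (b * t) * gamma_kernel p b) =
  t `^ (p - 1) * ((1 + t) `^ (1 - (p + p)) * gamma_kernel (p + p) ((1 + t) * b)).
Proof.
move=> b0 t0; have t10 : 0 < 1 + t by rewrite addr_gt0.
rewrite /gamma_kernel !mulr_gt0// b0 !powRM ?(ltW b0) ?(ltW t0) ?(ltW t10)//.
have -> : (1 + t) `^ (1 - (p + p)) * ((1 + t) `^ (p + p - 1) * b `^ (p + p - 1) *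
    expR (- ((1 + t) * b) / 2)) = b `^ (p + p - 1) * expR (- ((1 + t) * b) / 2).
  rewrite !mulrA -powRD ?(gt_eqF t10) ?implybT//.
  by rewrite (_ : 1 - (p + p) + (p + p - 1) = 0) ?powRr0 ?mul1r//; ring.
have -> : expR (- ((1 + t) * b) / 2) = expR (- (b * t) / 2) * expR (- b / 2).
  by rewrite -expRD; congr expR; field.
have -> : b `^ (p + p - 1) = b * (b `^ (p - 1) * b `^ (p - 1)).
  rewrite -powRD ?(gt_eqF b0) ?implybT// -{2}[b]powRr1 ?(ltW b0)//.
  by rewrite -powRD ?(gt_eqF b0) ?implybT//; congr (_ `^ _); ring.
by ring.
Qed.

Lemma measurable_ratio_set (c : R) :
  measurable [set z : R * R | 0 < z.2 /\ c * z.2 < z.1].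
Proof.
set S := [set z | _].
rewrite (_ : S = [set z : R * R | (0 < z.2)%R && (c * z.2 < z.1)%R]); last first.
  by apply/seteqP; split => z /=; [case=> -> ->|move/andP].
rewrite -[X in measurable X]setTI.
have mf : measurable_fun setT (fun z : R * R => (0 < z.2)%R && (c * z.2 < z.1)%R).
  apply: measurable_and; apply: measurable_fun_ltr => //.
  by apply: measurable_funM => //; exact: measurable_snd.
by apply: mf.
Qed.

Local Open Scope ereal_scope.

(** Substitute [a = b t] at fixed [b], exchange the integrals, then substitute [u = (1 + t) b]: the
    integral over [u] is the constant [I]. The factor [e] does not depend on [c], so [c = 0] can
    later determine it. *)
Lemma gamma_ratio (p C : R) : (0 <= C)%R -> exists2 e : \bar R, 0 <= e &
  forall c : R, (0 <= c)%R ->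
  \int[mu]_a \int[mu]_b
    (\1_[set z : R * R | (0 < z.2)%R /\ (c * z.2 < z.1)%R] (a, b) *
     ((C * gamma_kernel p a) * (C * gamma_kernel p b)))%:E =
  e * \int[mu]_(t in `]c, +oo[) (beta_prime_kernel p t)%:E.
Proof.
move=> C0; have gk0 := @gamma_kernel_ge0 R.
have mgk := @measurable_gamma_kernel R.
pose I := \int[mu]_u (gamma_kernel (p + p) u)%:E.
have I0 : 0 <= I by apply: integral_ge0 => u _; rewrite lee_fin.
exists ((C * C)%:E * I); first by rewrite mule_ge0// lee_fin mulr_ge0.
move=> c c0.
pose S := [set z : R * R | (0 < z.2)%R /\ (c * z.2 < z.1)%R].
have mS : measurable S := measurable_ratio_set c.
have mk : measurable_fun setT (fun a => C * gamma_kernel p a)%R by exact: measurable_funM.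
have k0 a : (0 <= C * gamma_kernel p a)%R by rewrite mulr_ge0.
pose f (a b : R) := (\1_S (a, b) * ((C * gamma_kernel p a) * (C * gamma_kernel p b)))%:E.
have mf : measurable_fun setT (fun z : R * R => f z.1 z.2).
  have := measurable_indic_density mk mk mS.
  by apply: eq_measurable_fun => -[a b] _.
have f0 a b : 0 <= f a b by rewrite lee_fin; apply: mulr_ge0 => //; exact: mulr_ge0.
rewrite -[LHS]/(\int[mu]_a \int[mu]_b f a b) (tonelli2 mf f0).
pose g (b t : R) : \bar R := (if ((0 < b) && (c < t))%R then
  (C * C) * (t `^ (p - 1) * ((1 + t) `^ (1 - (p + p)) *
    gamma_kernel (p + p) ((1 + t) * b))) else 0)%R%:E.
have mg : measurable_fun setT (fun z : R * R => g z.1 z.2).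
  have m1 : measurable_fun setT (fun z : R * R => z.1) by exact: measurable_fst.
  have m2 : measurable_fun setT (fun z : R * R => z.2) by exact: measurable_snd.
  have m3 : measurable_fun setT (fun z : R * R => 1 + z.2)%R by exact: measurable_funD.
  apply/measurable_EFinP; apply: measurable_fun_ifT => //.
    by apply: measurable_and; exact: measurable_fun_ltr.
  apply: measurable_funM => //; apply: measurable_funM.
    exact: (measurableT_comp (measurable_powR _) m2).
  apply: measurable_funM; first exact: (measurableT_comp (measurable_powR _) m3).
  by apply: measurable_gamma_kernel_comp; exact: measurable_funM.
have g0 b t : 0 <= g b t.
  rewrite lee_fin; case: ifP => // _.
  by rewrite !(mulr_ge0 _ (mulr_ge0 _ _))// ?mulr_ge0 ?powR_ge0.
transitivity (\int[mu]_b \int[mu]_t g b t).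
  apply: eq_integral => b _; have [b0|b0] := ltP 0%R b; last first.
    rewrite !integral0_eq// => a _; first by rewrite /g ltNge b0.
    by rewrite /f indicE memNset ?mul0r//= => -[]; rewrite ltNge b0.
  have bn0 : b != 0%R by rewrite gt_eqF.
  have mfb : measurable_fun setT (f^~ b).
    apply/measurable_EFinP; apply: measurable_funM; last by apply: measurable_funM => //.
    apply: (measurableT_comp (measurable_indic mS)).
    by apply: measurable_fun_pair => //; exact: measurable_cst.
  rewrite (ge0_integral_affineZ 0 bn0 mfb (fun a => f0 a b)).
  apply: eq_integral => t _; rewrite addr0 gtr0_norm// /f -EFinM /g b0 indicE.
  have [ct|ct] := ltP c t; last first.
    by rewrite memNset ?mul0r ?mulr0//= => -[_]; rewrite mulrC ltr_pM2l// ltNge ct.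
  rewrite mem_set ?mul1r//=; last by split=> //; rewrite mulrC ltr_pM2l.
  rewrite -gamma_kernel_scaled//; last exact: le_lt_trans ct.
  by congr _%:E; ring.
rewrite (tonelli2 mg g0) [in RHS]integral_mkcond -ge0_integralZl//; last 3 first.
- apply/(measurable_restrictT (fun t => (beta_prime_kernel p t)%:E)) => //.
  by apply: measurable_funTS; apply/measurable_EFinP; exact: measurable_beta_prime_kernel.
- by move=> t _; rewrite patchE; case: ifP => // _; rewrite lee_fin beta_prime_kernel_ge0.
- by rewrite mule_ge0// lee_fin mulr_ge0.
apply: eq_integral => t _; rewrite patchE mem_setE in_itv/= andbT.
have [ct|ct] := ltP c t; last first.
  by rewrite mule0 integral0_eq// => b _; rewrite /g [(c < t)%R]ltNge ct andbF.
have t0 : (0 < t)%R by exact: le_lt_trans ct.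
have t10 : (0 < 1 + t)%R by rewrite addr_gt0.
have tn0 : (1 + t != 0)%R by rewrite gt_eqF.
have mgp : measurable_fun setT (fun u => (gamma_kernel (p + p) u)%:E).
  exact/measurable_EFinP.
have gp0 u : 0 <= (gamma_kernel (p + p) u)%:E by rewrite lee_fin.
rewrite /I (ge0_integral_affineZ 0 tn0 mgp gp0).
rewrite muleAC -EFinM muleC -ge0_integralZr//; last 3 first.
- apply: emeasurable_funM => //; exact: (measurableT_comp mgp (measurable_affine (1 + t)%R 0%R)).
- by move=> b _; rewrite mule_ge0// lee_fin.
- by rewrite lee_fin; apply: mulr_ge0; [exact: mulr_ge0|exact: beta_prime_kernel_ge0].
apply: eq_integral => b _; rewrite /g ct andbT addr0 -!EFinM; congr _%:E.
case: ifPn => b0; last first.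
  rewrite /gamma_kernel ifN; first by rewrite mulr0 mul0r.
  by rewrite pmulr_rgt0.
rewrite /beta_prime_kernel gtr0_norm//.
have -> : ((1 + t) `^ (1 - (p + p)) = (1 + t) * (1 + t) `^ (- (p + p)))%R.
  by rewrite powRD ?tn0 ?implybT// powRr1 ?(ltW t10).
by ring.
Qed.

End gamma_ratio.

Section ratio_of_sums_of_squares.
Context {R : realType} d (T : measurableType d) (P : probability T R).
Local Notation mu := (@lebesgue_measure R).

(** Block form of [iid_normal_head], with the last block moved into the event. *)
Lemma iid_normal_lshift (E : set T) m n (X : 'I_(m + n) -> T -> R)
    (B : 'I_n -> set R) :
  measurable E -> iid_normal P E X -> (forall i, measurable (B i)) ->
  let E1 := [set t | E t /\ forall i, B i (X (rshift m i) t)] in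
  [/\ measurable E1, P E1 = (P E * \prod_(i < n) normal_prob 0 1 (B i))%E &
      iid_normal P E1 (fun i => X (lshift n i))].
Proof.
move=> mE [mX PX] mB E1.
have PXl (A : 'I_m -> set R) : (forall i, measurable (A i)) ->
    P [set t | E1 t /\ forall i, A i (X (lshift n i) t)] =
    (P E * \prod_(i < n) normal_prob 0 1 (B i) *
     \prod_(i < m) normal_prob 0 1 (A i))%E.
  move=> mA.
  pose B' i := match fintype.split i with inl k => A k | inr k => B k end.
  have mB' i : measurable (B' i) by rewrite /B'; case: fintype.split.
  have B'l i : B' (lshift n i) = A i by rewrite /B' -[lshift n i]/(unsplit (inl i)) unsplitK.
  have B'r i : B' (rshift m i) = B i by rewrite /B' -[rshift m i]/(unsplit (inr i)) unsplitK.
  have := PX B' mB'; rewrite big_split_ord/=.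
  under eq_bigr do rewrite B'l.
  under [X in (_ * (_ * X))%E]eq_bigr do rewrite B'r.
  rewrite [X in (P E * X)%E]muleC muleA => <-; congr (P _); apply/seteqP; split => t /=.
    move=> [[Et Bt] At]; split=> // i; rewrite /B'.
    by case: split_ordP => k ->.
  move=> [Et B't]; split; first split=> // i; last move=> i.
    by have := B't (rshift m i); rewrite B'r.
  by have := B't (lshift n i); rewrite B'l.
have PE1 : P E1 = (P E * \prod_(i < n) normal_prob 0 1 (B i))%E.
  have := PXl (fun=> setT) (fun=> measurableT).
  rewrite [X in (_ * X)%E]big1 ?mule1; last by move=> i _; rewrite probability_setT.
  by move=> <-; congr (P _); apply/seteqP; split => t /=; [|case].
split => //; last by split => // A mA; rewrite PE1 PXl.
rewrite (_ : E1 = E `&` \bigcap_(i in setT) [set t | B i (X (rshift m i) t)]); last first.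
  by apply/seteqP; split => t /= [Et Bt]; split=> // i; [move=> _|]; exact: Bt.
apply: measurableI => //; apply: fin_bigcap_measurable; first exact: finite_finset.
by move=> i _; rewrite -[X in measurable X]setTI; exact: mX.
Qed.

(** Both probabilities, for [c] and for 0, are the same constant times a tail integral of one
    kernel. The one for 0 equals 1, so the constant is the inverse of the full integral in the
    denominator of [QF]. *)
Lemma F_law n (X : 'I_(n + n) -> T -> R) (c : R) : (0 < n)%N -> 0 < c ->
  iid_normal P setT X ->
  P [set t | 0 < \sum_i X (rshift n i) t ^+ 2 /\
    c * \sum_i X (rshift n i) t ^+ 2 < \sum_i X (lshift n i) t ^+ 2] =
  (QF n n c)%:E.
Proof.
case: n X => // n X _ c0 HX; have [mX _] := HX.
have [C [C0 tot law]] := sum_sqr_law P n.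
set p := n.+1%:R / 2 in tot law.
pose U t := \sum_i X (lshift n.+1 i) t ^+ 2.
pose V t := \sum_i X (rshift n.+1 i) t ^+ 2.
have mU : measurable_fun setT U by apply: measurable_sum => i; exact: measurable_funX.
have mV : measurable_fun setT V by apply: measurable_sum => i; exact: measurable_funX.
pose k x := C * gamma_kernel p x.
have mk : measurable_fun setT k.
  by apply: measurable_funM => //; exact: measurable_gamma_kernel.
have k0 x : 0 <= k x by rewrite mulr_ge0// gamma_kernel_ge0.
have PUV A B : measurable A -> measurable B ->
    P [set t | [/\ setT t, A (U t) & B (V t)]] =
    (P setT * (\int[mu]_(x in A) (k x)%:E * \int[mu]_(y in B) (k y)%:E))%E.
  move=> mA mB; rewrite probability_setT mul1e.
  have PA : P [set t | A (U t)] = (\int[mu]_(x in A) (k x)%:E)%E.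
    have [mE PE EX] := iid_normal_lshift (measurableT) HX (fun=> measurableT).
    have := law _ _ _ mE EX mA; rewrite PE probability_setT mul1e big1 ?mul1e.
      by move=> <-; congr (P _); apply/seteqP; split => t /=; [|case].
    by move=> i _; rewrite probability_setT.
  have mEA : measurable [set t | A (U t)].
    by rewrite -[X in measurable X]setTI; exact: mU.
  (* Independence of the two sums: the second block stays standard given any event on [U], by the
     law of [U] relative to constraints on the second block. *)
  have EA : iid_normal P [set t | A (U t)] (fun i => X (rshift n.+1 i)).
    split=> // D mD.
    have [mE PE EX] := iid_normal_lshift (measurableT) HX mD.
    have := law _ _ _ mE EX mA; rewrite PE probability_setT mul1e PA muleC => <-.
    by congr (P _); apply/seteqP; split => t /=; [case|move=> [[]]].
  rewrite -PA -(law _ _ _ mEA EA mB).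
  by congr (P _); apply/seteqP; split => t /=; [case|move=> []].
have [e e0 eE] := gamma_ratio p C0.
pose J a := (\int[mu]_(t in `]a, +oo[) (beta_prime_kernel p t)%:E)%E.
have J0 a : (0 <= J a)%E.
  by apply: integral_ge0 => t _; rewrite lee_fin beta_prime_kernel_ge0.
(* The set for [c = 0] is the open positive quadrant, which carries all the mass because the kernels
   vanish elsewhere. *)
have eJ : (e * J 0%R = 1)%E.
  rewrite /J -eE//.
  have := integral2_rectangle mk mk k0 k0 measurableT measurableT.
  rewrite tot mule1 => <-.
  apply: eq_integral => a _; apply: eq_integral => b _; rewrite setXTT indicT mul1r.
  have [b0|b0] := ltP 0 b; last first.
    by rewrite /k /gamma_kernel [0 < b]ltNge b0/= !mulr0.
  have [a0|a0] := ltP 0 a; last first.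
    by rewrite /k /gamma_kernel [0 < a]ltNge a0/= !(mulr0, mul0r).
  by rewrite indicE mem_set ?mul1r//= mul0r.
have [e' e'0 eE'] := mule_eq1_fin e0 (J0 0%R) eJ.
have [j j0 jE] : exists2 j, 0 <= j & J 0%R = j%:E.
  by apply: (mule_eq1_fin (J0 0%R) e0); rewrite muleC.
have ej : e' * j = 1 by move: eJ; rewrite eE' jE -EFinM => -[].
have Jc : (J c <= J 0%R)%E.
  apply: ge0_subset_integral => //.
  - by apply: measurable_funTS; apply/measurable_EFinP; exact: measurable_beta_prime_kernel.
  - by move=> t _; rewrite lee_fin beta_prime_kernel_ge0.
  - by move=> t /=; rewrite !in_itv/= !andbT; exact: lt_trans.
have [jc jcE] : exists jc, J c = jc%:E.
  by exists (fine (J c)); rewrite fineK// ge0_fin_numE// (le_lt_trans Jc)// jE ltry.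
have QFE : QF n.+1 n.+1 c = jc / j.
  have JE a : (\int[mu]_(t in `]a, +oo[) (F_kernel n.+1 n.+1 t)%:E = J a)%E.
    by apply: eq_integral => t _; rewrite F_kernel_diag.
  rewrite /QF /Rintegral.
  have -> : (`]c, +oo[ `&` `]0, +oo[ = `]c, +oo[)%classic.
    apply: setIidl => t /=; rewrite !in_itv/= !andbT; exact: lt_trans.
  by rewrite !JE jE jcE.
have {QFE}-> : QF n.+1 n.+1 c = e' * jc.
  rewrite QFE.
  have jn0 : j != 0.
    by apply/eqP => jz; move: ej; rewrite jz mulr0 => /eqP; rewrite eq_sym oner_eq0.
  by apply: (mulIf jn0); rewrite divfK// mulrAC ej mul1r.
rewrite EFinM -jcE -eE' /J -eE ?(ltW c0)//.
pose S := [set z : R * R | 0 < z.2 /\ c * z.2 < z.1].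
rewrite -[RHS]mul1e -(probability_setT P).
rewrite -(joint_density mk mk k0 k0 measurableT mU mV PUV (measurable_ratio_set c)).
by congr (P _); apply/seteqP; split => t /=; [|case].
Qed.

End ratio_of_sums_of_squares.

(** * The detector: standardised variables, covariances and the test *)

Section standardization.
Context {R : realType} d (T : measurableType d) (P : probability T R).

Lemma dot_enum_val (I : finType) (f g : I -> R) :
  dot (fun k : 'I_#|I| => f (enum_val k)) (fun k => g (enum_val k)) = \sum_i f i * g i.
Proof. by rewrite [RHS](reindex _ (onW_bij _ (enum_val_bij _))). Qed.

Lemma iid_normal_standardized (I : finType) (s : I -> R) (W : I -> T -> R) :
  (forall i, 0 < s i) -> (forall i, has_normal_law P (s i) (W i)) ->
  mutually_independent P W ->
  iid_normal P setT (fun (k : 'I_#|I|) t => (s (enum_val k))^-1 * W (enum_val k) t).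
Proof.
move=> s0 WN Wind; split.
  by move=> k; apply: measurable_funM => //; have [] := WN (enum_val k).
move=> B mB; rewrite probability_setT mul1e.
pose B' i := [set x | B (enum_rank i) ((s i)^-1 * x)].
have mB' i : measurable (B' i).
  rewrite -[X in measurable X]setTI.
  have mf : measurable_fun setT (fun x : R => (s i)^-1 * x) by exact: measurable_funM.
  exact: mf.
transitivity (P (\bigcap_(i in [set: I]) (W i @^-1` B' i))).
  congr (P _); apply/seteqP; split => t /=.
    by move=> [_ Bt] i _; have := Bt (enum_rank i); rewrite enum_rankK.
  by move=> Bt; split=> // k; have := Bt (enum_val k) Logic.I; rewrite /B' /= enum_valK.
rewrite Wind// (reindex _ (onW_bij _ (enum_val_bij _)))/=.
apply: eq_bigr => k _; have [_ WE] := WN (enum_val k).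
rewrite (WE _ (mB' _)) /B' enum_valK; apply: normal_prob_scale => //.
by rewrite normfV gtr0_norm// mulVf// gt_eqF.
Qed.

End standardization.

Lemma big_triple (R : pzSemiRingType) (A B C : finType) (F : A -> B -> C -> R) :
  \sum_(p : A * B * C) F p.1.1 p.1.2 p.2 = \sum_a \sum_b \sum_c F a b c.
Proof.
rewrite (pair_bigA _ (fun a b => \sum_c F a b c)).
by rewrite (pair_bigA _ (fun p c => F p.1 p.2 c)).
Qed.

Section detector.
Context {R : realType} (N K M1 M2 Nb : nat).
Local Notation M := (M1 + M2)%N.
Local Notation I := ('I_M * 'I_Nb * 'I_N + 'I_Nb * 'I_K)%type.

(** The noise part is a tensor product of device weights [q] and a sensing vector [v], so that inner
    products factor; [h] is the signal part, common to all devices. *)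
Definition snapshot_coef (n : 'I_Nb) (q : 'I_M -> R) (v : 'cV[R]_N) (h : 'cV[R]_K)
    (i : I) : R :=
  match i with
  | inl (m, n', j) => (n' == n)%:R * (q m * v j 0)
  | inr (n', k) => (n' == n)%:R * h k 0
  end.

Lemma sum_snapshot_coef n q v h (X : I -> R) :
  \sum_i snapshot_coef n q v h i * X i =
  \sum_m q m * \sum_j v j 0 * X (inl (m, n, j)) + \sum_k h k 0 * X (inr (n, k)).
Proof.
rewrite big_sumType/=; congr (_ + _).
  transitivity (\sum_m \sum_n' \sum_j
      snapshot_coef n q v h (inl (m, n', j)) * X (inl (m, n', j))).
    rewrite -(big_triple (fun m n' j =>
      snapshot_coef n q v h (inl (m, n', j)) * X (inl (m, n', j)))).
    by refine (eq_bigr _ _) => -[[m n'] j] _.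
  apply: eq_bigr => m _; rewrite (bigD1 n)//= [X in _ + X]big1 ?addr0.
    by rewrite mulr_sumr; apply: eq_bigr => j _; rewrite eqxx mul1r mulrA.
  by move=> n' /negbTE n'n; rewrite big1// => j _; rewrite n'n !mul0r.
transitivity (\sum_n' \sum_k
    snapshot_coef n q v h (inr (n', k)) * X (inr (n', k))).
  by rewrite pair_bigA; refine (eq_bigr _ _) => -[n' k] _.
rewrite (bigD1 n)//= [X in _ + X]big1 ?addr0.
  by apply: eq_bigr => k _; rewrite eqxx mul1r.
by move=> n' /negbTE n'n; rewrite big1// => k _; rewrite n'n !mul0r.
Qed.

Lemma sum_snapshot_coef2 n q v h n2 q2 v2 h2 :
  \sum_i snapshot_coef n q v h i * snapshot_coef n2 q2 v2 h2 i =
  (n == n2)%:R * ((\sum_m q m * q2 m) * (v^T *m v2) 0 0 + (h^T *m h2) 0 0).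
Proof.
rewrite sum_snapshot_coef !mxE mulrDr /=; congr (_ + _).
  rewrite mulr_suml mulr_sumr; apply: eq_bigr => m _.
  rewrite -mulrA mulrCA; congr (_ * _).
  rewrite !mulr_sumr; apply: eq_bigr => j _; rewrite mxE; ring.
by rewrite mulr_sumr; apply: eq_bigr => k _; rewrite mxE; ring.
Qed.

Lemma row_sample (Ph : 'M[R]_(M, N)) (H : 'M[R]_(N, K)) (m : 'I_M) (r : R)
    (v wv : 'cV[R]_N) (xv : 'cV[R]_K) : (forall j, Ph m j = r * v j 0) ->
  (row m Ph *m (H *m xv + wv)) 0 0 =
  r * (\sum_k (H^T *m v) k 0 * xv k 0 + \sum_j v j 0 * wv j 0).
Proof.
move=> PhE.
transitivity (r * ((v^T *m (H *m xv)) 0 0 + (v^T *m wv) 0 0)).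
  rewrite (_ : row m Ph = r *: v^T); last by apply/rowP => j; rewrite !mxE PhE.
  by rewrite -scalemxAl mxE mulmxDr [in LHS]mxE.
congr (r * (_ + _)); last by rewrite mxE; apply: eq_bigr => j _; rewrite mxE.
rewrite mulmxA -[v^T *m H]trmxK trmx_mul trmxK mxE.
by apply: eq_bigr => k _; rewrite mxE.
Qed.

Context d (T : measurableType d) (P : probability T R).
Variables (H : 'M[R]_(N, K)) (u1 uN : 'cV[R]_N) (rho1 rhoN s0 sx gamma : R).
Variables (w : 'I_M -> 'I_Nb -> 'I_N -> T -> R) (x : 'I_Nb -> 'I_K -> T -> R).

(** Here [rho1] and [rhoN] are the eigenvalues themselves. Both may be 0, so that a zero [H] is
    covered. *)
Lemma energy_detector :
  (u1^T *m u1) 0 0 = 1 -> (uN^T *m uN) 0 0 = 1 -> (u1^T *m uN) 0 0 = 0 ->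
  H *m H^T *m u1 = rho1 *: u1 -> H *m H^T *m uN = rhoN *: uN ->
  0 <= rho1 -> 0 <= rhoN -> (0 < M1)%N -> (0 < M2)%N -> (0 < Nb)%N ->
  0 < s0 -> 0 < sx -> 0 < gamma ->
  (forall m n j, has_normal_law P s0 (w m n j)) ->
  (forall n k, has_normal_law P sx (x n k)) ->
  mutually_independent P
    (fun i : I => match i with inl (m, n, j) => w m n j | inr (n, k) => x n k end) ->
  P [set t | gamma < Tstat (z_H1 (Phi M1 M2 u1 uN) H w x) t] =
  (QF Nb Nb ((s0 ^+ 2 + M2%:R * sx ^+ 2 * rhoN) /
             (s0 ^+ 2 + M1%:R * sx ^+ 2 * rho1) * gamma))%:E.
Proof.
move=> u11 uNN u1N Hu1 HuN rho10 rhoN0 M10 M20 Nb0 s00 sx0 gamma0 wN xN wxind.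
set Ph := Phi M1 M2 u1 uN.
pose W (i : I) : T -> R := match i with inl (m, n, j) => w m n j | inr (n, k) => x n k end.
pose s (i : I) : R := match i with inl _ => s0 | inr _ => sx end.
have s_gt0 i : 0 < s i by case: i.
have WN i : has_normal_law P (s i) (W i).
  by case: i => [[[m n] j]|[n k]]; [exact: wN|exact: xN].
have Z := iid_normal_standardized s_gt0 WN wxind.
pose r : R := (Num.sqrt M%:R)^-1.
have r0 : 0 < r by rewrite invr_gt0 sqrtr_gt0 ltr0n addn_gt0 M10.
have M1R : 0 < M1%:R :> R by rewrite ltr0n.
have M2R : 0 < M2%:R :> R by rewrite ltr0n.
(* Noise deviation [s0], row scaling [r], averaging over [M1] devices. The supports of [qs] and [qo]
   are disjoint. *)
pose qs (m : 'I_M) : R := if fintype.split m is inl _ then s0 * r / M1%:R else 0.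
pose qo (m : 'I_M) : R := if fintype.split m is inr _ then s0 * r / M2%:R else 0.
have qsl m : qs (lshift M2 m) = s0 * r / M1%:R.
  by rewrite /qs -[lshift _ _]/(unsplit (inl m)) unsplitK.
have qsr m : qs (rshift M1 m) = 0.
  by rewrite /qs -[rshift _ _]/(unsplit (inr m)) unsplitK.
have qol m : qo (lshift M2 m) = 0.
  by rewrite /qo -[lshift _ _]/(unsplit (inl m)) unsplitK.
have qor m : qo (rshift M1 m) = s0 * r / M2%:R.
  by rewrite /qo -[rshift _ _]/(unsplit (inr m)) unsplitK.
(* The devices of a block receive the same signal, so averaging does not reduce it and no [M1] or
   [M2] appears. *)
pose hs := (sx * r) *: (H^T *m u1); pose ho := (sx * r) *: (H^T *m uN).
pose As n := snapshot_coef n qs u1 hs; pose Ao n := snapshot_coef n qo uN ho.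
have Hdot (v1 v2 : 'cV[R]_N) rho : H *m H^T *m v2 = rho *: v2 ->
    (((sx * r) *: (H^T *m v1))^T *m ((sx * r) *: (H^T *m v2))) 0 0 =
    (sx * r) ^+ 2 * rho * (v1^T *m v2) 0 0.
  move=> Hv2; rewrite [(_ *: _)^T]linearZ/= trmx_mul trmxK -scalemxAl -scalemxAr scalerA.
  by rewrite mulmxA -(mulmxA v1^T) -mulmxA Hv2 -scalemxAr scalerA mxE expr2.
pose va := s0 ^+ 2 + M1%:R * sx ^+ 2 * rho1.
pose vb := s0 ^+ 2 + M2%:R * sx ^+ 2 * rhoN.
have va0 : 0 < va by rewrite ltr_pwDl ?exprn_gt0// mulr_ge0// mulr_ge0 ?ler0n ?sqr_ge0.
have vb0 : 0 < vb by rewrite ltr_pwDl ?exprn_gt0// mulr_ge0// mulr_ge0 ?ler0n ?sqr_ge0.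
(* The variances of the two averages: [ns] is the noise part [(s0 r)^2 / M1] plus the signal part
   [(sx r)^2 rho1], and [no] is analogous. *)
pose ns := r ^+ 2 / M1%:R * va; pose no := r ^+ 2 / M2%:R * vb.
have ns0 : 0 < ns by rewrite mulr_gt0// mulr_gt0 ?invr_gt0// exprn_gt0.
have no0 : 0 < no by rewrite mulr_gt0// mulr_gt0 ?invr_gt0// exprn_gt0.
have qss : \sum_m qs m * qs m = (s0 * r) ^+ 2 / M1%:R.
  rewrite big_split_ord/= [X in _ + X]big1 ?addr0; last by move=> m _; rewrite qsr mul0r.
  under eq_bigr do rewrite qsl.
  by rewrite sumr_const card_ord -[_ *+ _]mulr_natr; field; rewrite gt_eqF.
have qoo : \sum_m qo m * qo m = (s0 * r) ^+ 2 / M2%:R.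
  rewrite big_split_ord/= [X in X + _]big1 ?add0r; last by move=> m _; rewrite qol mul0r.
  under eq_bigr do rewrite qor.
  by rewrite sumr_const card_ord -[_ *+ _]mulr_natr; field; rewrite gt_eqF.
have qso : \sum_m qs m * qo m = 0.
  apply: big1 => m _; case: (split_ordP m) => m' ->; first by rewrite qol mulr0.
  by rewrite qsr mul0r.
have dss n n' : \sum_i As n i * As n' i = (n == n')%:R * ns.
  rewrite sum_snapshot_coef2 u11 (Hdot _ _ _ Hu1) u11 qss /ns /va.
  by congr (_ * _); field; rewrite gt_eqF.
have doo n n' : \sum_i Ao n i * Ao n' i = (n == n')%:R * no.
  rewrite sum_snapshot_coef2 uNN (Hdot _ _ _ HuN) uNN qoo /no /vb.
  by congr (_ * _); field; rewrite gt_eqF.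
have dso n n' : \sum_i As n i * Ao n' i = 0.
  by rewrite sum_snapshot_coef2 (Hdot _ _ _ HuN) u1N qso mul0r mulr0 addr0 mulr0.
pose a (i : 'I_(Nb + Nb)) (k : 'I_#|{: I}|) : R := match fintype.split i with
  | inl n => (Num.sqrt ns)^-1 * As n (enum_val k)
  | inr n => (Num.sqrt no)^-1 * Ao n (enum_val k) end.
have al n : a (lshift Nb n) = fun k => (Num.sqrt ns)^-1 * As n (enum_val k).
  by rewrite /a -[lshift _ _]/(unsplit (inl n)) unsplitK.
have ar n : a (rshift Nb n) = fun k => (Num.sqrt no)^-1 * Ao n (enum_val k).
  by rewrite /a -[rshift _ _]/(unsplit (inr n)) unsplitK.
have sns : Num.sqrt ns ^+ 2 = ns by rewrite sqr_sqrtr// ltW.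
have sno : Num.sqrt no ^+ 2 = no by rewrite sqr_sqrtr// ltW.
have sns0 : Num.sqrt ns != 0 by rewrite gt_eqF// sqrtr_gt0.
have sno0 : Num.sqrt no != 0 by rewrite gt_eqF// sqrtr_gt0.
have dotZ (c e : R) (f g : I -> R) :
    dot (fun k : 'I_#|{: I}| => c * f (enum_val k)) (fun k => e * g (enum_val k)) =
    c * e * \sum_i f i * g i.
  rewrite (dot_enum_val (fun i => c * f i) (fun i => e * g i)) mulr_sumr.
  by apply: eq_bigr => i _; rewrite mulrACA.
have aa i j : dot (a i) (a j) = (i == j)%:R.
  case: (split_ordP i) => n ->; case: (split_ordP j) => n' ->; rewrite ?al ?ar dotZ.
  - by rewrite dss (inj_eq (@lshift_inj _ _)) mulrCA -{3}sns; field.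
  - by rewrite dso mulr0 eq_lrshift.
  - rewrite eq_rlshift; under eq_bigr do rewrite mulrC.
    by rewrite dso mulr0.
  - by rewrite doo (inj_eq (@rshift_inj _ _)) mulrCA -{3}sno; field.
have Y := iid_normal_orthonormal measurableT Z aa.
set X' := (fun (i : 'I_(Nb + Nb)) t => _) in Y.
have PhlE m j : Ph (lshift M2 m) j = r * u1 j 0.
  by rewrite !mxE -[lshift _ _]/(unsplit (inl m)) unsplitK mxE big_ord1 !mxE mul1r.
have PhrE m j : Ph (rshift M1 m) j = r * uN j 0.
  by rewrite !mxE -[rshift _ _]/(unsplit (inr m)) unsplitK mxE big_ord1 !mxE mul1r.
have dotA (c : R) (f : I -> R) t :
    dot (fun k : 'I_#|{: I}| => c * f (enum_val k))
      (fun k => (s (enum_val k))^-1 * W (enum_val k) t) =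
    c * \sum_i f i * ((s i)^-1 * W i t).
  rewrite (dot_enum_val (fun i => c * f i) (fun i => (s i)^-1 * W i t)) mulr_sumr.
  by apply: eq_bigr => i _; rewrite mulrA.
have zl m n t : z_H1 Ph H w x (lshift M2 m) n t =
    r * \sum_k (H^T *m u1) k 0 * x n k t + r * \sum_j u1 j 0 * w (lshift M2 m) n j t.
  rewrite /z_H1 (row_sample _ _ _ (PhlE m)) mulrDr; congr (r * _ + r * _);
    by apply: eq_bigr => i _; congr (_ * _); rewrite mxE.
have zr m n t : z_H1 Ph H w x (rshift M1 m) n t =
    r * \sum_k (H^T *m uN) k 0 * x n k t + r * \sum_j uN j 0 * w (rshift M1 m) n j t.
  rewrite /z_H1 (row_sample _ _ _ (PhrE m)) mulrDr; congr (r * _ + r * _);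
    by apply: eq_bigr => i _; congr (_ * _); rewrite mxE.
have zsE n t : zbar_s (z_H1 Ph H w x) n t = Num.sqrt ns * X' (lshift Nb n) t.
  rewrite /X' al dotA mulVKf// sum_snapshot_coef big_split_ord/=.
  rewrite [X in _ + X + _]big1 ?addr0; last by move=> m _; rewrite qsr mul0r.
  rewrite /zbar_s (eq_bigr _ (fun m _ => zl m n t)) big_split/=.
  rewrite sumr_const card_ord mulrDr addrC; congr (_ + _).
    rewrite mulr_sumr; apply: eq_bigr => m _; rewrite qsl !mulr_sumr.
    by apply: eq_bigr => j _; field; rewrite !gt_eqF.
  rewrite -[(r * _) *+ _]mulr_natl mulKf ?gt_eqF// mulr_sumr; apply: eq_bigr => k _.
  by rewrite !mxE; field; rewrite gt_eqF.
have zoE n t : zbar_o (z_H1 Ph H w x) n t = Num.sqrt no * X' (rshift Nb n) t.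
  rewrite /X' ar dotA mulVKf// sum_snapshot_coef big_split_ord/=.
  rewrite [X in X + _ + _]big1 ?add0r; last by move=> m _; rewrite qol mul0r.
  rewrite /zbar_o (eq_bigr _ (fun m _ => zr m n t)) big_split/=.
  rewrite sumr_const card_ord mulrDr addrC; congr (_ + _).
    rewrite mulr_sumr; apply: eq_bigr => m _; rewrite qor !mulr_sumr.
    by apply: eq_bigr => j _; field; rewrite !gt_eqF.
  rewrite -[(r * _) *+ _]mulr_natl mulKf ?gt_eqF// mulr_sumr; apply: eq_bigr => k _.
  by rewrite !mxE; field; rewrite gt_eqF.
(* The weights [M1] and [M2] of the statistic cancel the [1 / M1] and [1 / M2] in [ns] and [no], and
   [r^2] is common to both. *)
have TE t : Tstat (z_H1 Ph H w x) t =
    va * (\sum_n X' (lshift Nb n) t ^+ 2) / (vb * \sum_n X' (rshift Nb n) t ^+ 2).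
  rewrite /Tstat; under eq_bigr do rewrite zsE exprMn sns.
  under [X in _ / (_ * X)]eq_bigr do rewrite zoE exprMn sno.
  rewrite -!mulr_sumr.
  have -> : M1%:R * (ns * \sum_n X' (lshift Nb n) t ^+ 2) =
      r ^+ 2 * (va * \sum_n X' (lshift Nb n) t ^+ 2).
    by rewrite /ns; field; rewrite gt_eqF.
  have -> : M2%:R * (no * \sum_n X' (rshift Nb n) t ^+ 2) =
      r ^+ 2 * (vb * \sum_n X' (rshift Nb n) t ^+ 2).
    by rewrite /no; field; rewrite gt_eqF.
  by rewrite -mulf_div divff ?mul1r// expf_neq0// gt_eqF.
have c0 : 0 < vb / va * gamma by rewrite !mulr_gt0 ?invr_gt0.
rewrite -/va -/vb -(F_law Nb0 c0 Y); congr (P _); apply/seteqP; split => t /=.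
  rewrite TE => gT.
  (* If this sum were 0, the quotient would be 0 by convention, against [0 < gamma]. *)
  have V0 : 0 < \sum_n X' (rshift Nb n) t ^+ 2.
    rewrite lt_neqAle sumr_ge0 ?andbT; last by move=> n _; exact: sqr_ge0.
    by apply/eqP => V0; move: gT; rewrite -V0 mulr0 invr0 mulr0 ltNge (ltW gamma0).
  split=> //; move: gT; rewrite ltr_pdivlMr ?mulr_gt0// => gT.
  rewrite -(ltr_pM2l va0); apply: le_lt_trans gT.
  by rewrite le_eqVlt; apply/orP; left; apply/eqP; field; rewrite gt_eqF.
move=> [V0]; rewrite -(ltr_pM2l va0) TE ltr_pdivlMr ?mulr_gt0//.
apply: le_lt_trans; rewrite le_eqVlt; apply/orP; left; apply/eqP.
by field; rewrite gt_eqF.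
Qed.

End detector.

(** Indices start at 0: [u 0] and [u N.-1] are the first and last eigenvectors. [rho2] lists the
    squares, while [s0] and [sx] are standard deviations. *)
Theorem theorem4 (R : realType) (N K M1 M2 Nb : nat)
  (H : 'M[R]_(N, K)) (u : nat -> 'cV[R]_N) (rho2 : nat -> R)
  (s0 sx gamma : R)
  (d : measure_display) (T : measurableType d) (P : probability T R)
  (w : 'I_(M1 + M2) -> 'I_Nb -> 'I_N -> T -> R)
  (x : 'I_Nb -> 'I_K -> T -> R) :
  (1 <= K)%N -> (K <= N)%N -> \rank H = K ->
  (forall i j, (i < N)%N -> (j < N)%N -> (u i)^T *m u j = (i == j)%:R%:M) ->
  (forall i, (i < N)%N -> H *m H^T *m u i = rho2 i *: u i) ->
  (forall i j, (i <= j)%N -> (j < N)%N -> rho2 j <= rho2 i) ->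
  0 <= rho2 N.-1 -> rho2 N.-1 < rho2 0%N ->
  (0 < M1)%N -> (0 < M2)%N -> (0 < Nb)%N ->
  0 < s0 -> 0 < sx -> 0 < gamma ->
  (forall m n j, has_normal_law P s0 (w m n j)) ->
  (forall n k, has_normal_law P sx (x n k)) ->
  mutually_independent P
    (fun i : ('I_(M1 + M2) * 'I_Nb * 'I_N + 'I_Nb * 'I_K)%type =>
       match i with
       | inl (m, n, j) => w m n j
       | inr (n, k) => x n k
       end) ->
  let Ph := Phi M1 M2 (u 0%N) (u N.-1) in
  P [set t | gamma < Tstat (z_H0 Ph w) t] = (QF Nb Nb gamma)%:E /\
  P [set t | gamma < Tstat (z_H1 Ph H w x) t] =
    (QF Nb Nb ((s0 ^+ 2 + M2%:R * sx ^+ 2 * rho2 N.-1) /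
               (s0 ^+ 2 + M1%:R * sx ^+ 2 * rho2 0%N) * gamma))%:E.
Proof.
move=> K1 KN _ uu Hu _ rhoN0 rho1N M10 M20 Nb0 s00 sx0 gamma0 wN xN ind Ph.
have N0 : (0 < N)%N by exact: leq_trans K1 KN.
have NN : (N.-1 < N)%N by rewrite prednK.
(* The strict gap between the extreme eigenvalues excludes [N = 1], so the two sensing vectors are
   distinct, hence orthogonal. *)
have N1 : (0 == N.-1)%N = false.
  by apply/eqP => N1; move: rho1N; rewrite -N1 ltxx.
have u00 : ((u 0%N)^T *m u 0%N) 0 0 = 1 by rewrite uu// mxE.
have uNN : ((u N.-1)^T *m u N.-1) 0 0 = 1 by rewrite uu// eqxx mxE.
have u0N : ((u 0%N)^T *m u N.-1) 0 0 = 0 by rewrite uu// N1 mxE mul0rn.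
split; last first.
  by apply: energy_detector => //; [exact: Hu|exact: Hu|rewrite ltW// (le_lt_trans rhoN0)].
have -> : z_H0 Ph w = z_H1 Ph 0 w x.
  apply/funext => m; apply/funext => n; apply/funext => t.
  by rewrite /z_H0 /z_H1 mul0mx add0r.
(* With zero eigenvalues the threshold factor is [s0^2 / s0^2 = 1]. *)
rewrite (energy_detector (rho1 := 0) (rhoN := 0) (s0 := s0) (sx := sx))//; last 2 first.
- by rewrite !mul0mx scale0r.
- by rewrite !mul0mx scale0r.
by rewrite !mulr0 !addr0 divff ?mul1r// expf_neq0// gt_eqF.
Qed.
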